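(* Let $\beta > \beta^- \geq 1$ be integers, and let $r$ be the optimal objective value of the factor-revealing linear program $\mathrm{LP}(\beta,\beta^-)$ described in the context. Then for every bipartite graph $G$ and every $(\beta,\beta^-)$-EDCS $H \subseteq G$, it holds that $r \cdot \mu(H) \geq \mu(G)$. Furthermore, there exist a bipartite graph $G$ and a $(\beta,\beta^-)$-EDCS $H\subseteq G$ for which $r\cdot \mu(H) = \mu(G)$. (That is, $r$ is exactly the worst-case approximation ratio $\mu(G)/\mu(H)$ of $(\beta,\beta^-)$-EDCS on bipartite graphs.)
   Context: For a graph $G$, $\mu(G)$ denotes the size of a maximum matching of $G$ and $\deg_H(u)$ the degree of $u$ in a subgraph $H$. Given a graph $G$ and integers $\beta>\beta^-\ge 1$, a subgraph $H\subseteq G$ is a $(\beta,\beta^-)$-EDCS (edge-degree constrained subgraph) if (1) for every edge $(u,v)\in H$, $\deg_H(u)+\deg_H(v)\le \beta$, and (2) for every edge $(u,v)\in G\setminus H$, $\deg_H(u)+\deg_H(v)\ge \beta^-$. The linear program $\mathrm{LP}(\beta,\beta^-)$ is defined as follows. There are four ''position classes'': $\mathsf{A}$ and $\mathsf{L\setminus A}$ (called left classes) and $\mathsf{N}$ and $\mathsf{R\setminus N}$ (called right classes). A vertex profile is a tuple $\mathsf{v}=(s,d,m,m^* )$ with $s$ a position class, $d\in\{0,1,\dots,\beta-1\}$ (write $\mathsf{v}_{\deg}=d$), and $m,m^*\in\{\text{true},\text{false}\}$. It is valid if (i) whenever $s\in\{\mathsf{N},\mathsf{L\setminus A}\}$ then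 $m=\text{true}$, and (ii) whenever $d=0$ then $m=\text{false}$. Let $VP$ be the set of valid vertex profiles. An edge profile is a tuple $\mathsf{e}=(\mathsf{v}_L,\mathsf{v}_R,h,m,m^* )$ where $\mathsf{v}_L\in VP$ has a left class, $\mathsf{v}_R\in VP$ has a right class, and $h,m,m^*\in\{\text{true},\text{false}\}$ (meaning: the edge is in $H$, in $M$, in $M^*$). It is valid if all of the following hold: (1) if $h$ then both $\mathsf{v}_L,\mathsf{v}_R$ have nonzero degree; (2) if $m$ then both $\mathsf{v}_L,\mathsf{v}_R$ have $m$-component true, and if $m^*$ then both have $m^*$-component true; (3) if $m$ then $h$; (4) $h$ or $m^*$ is true; (5) if $h$ then $(\mathsf{v}_L)_{\deg}+(\mathsf{v}_R)_{\deg}\le\beta$; (6) if not $h$ then $(\mathsf{v}_L)_{\deg}+(\mathsf{v}_R)_{\deg}\ge\beta^-$; (7) if $h$ then it is not the case that $\mathsf{v}_L$ has class $\mathsf{A}$ and $\mathsf{v}_R$ has class $\mathsf{R\setminus N}$; (8) if $m$ then exactly one of the following holds: $\mathsf{v}_R$ has class $\mathsf{N}$, or $\mathsf{v}_L$ has class $\mathsf{L\setminus A}$. Let $EP$ be the set of valid edge profiles. We say $\mathsf{e}\in H$ (resp. $\mathsf{e}\in M$, $\mathsf{e}\in M^*$) if its $h$ (resp. $m$, $m^*$) component is true. For $\mathsf{v}\in VP$, let $H(\mathsf{v})$ (resp. $M(\mathsf{v})$, $M^*(\mathsf{v})$) be the set of $\mathsf{e}\in EP$ with $\mathsf{e}\in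 H$ (resp. $M$, $M^*$) such that $\mathsf{v}_L=\mathsf{v}$ or $\mathsf{v}_R=\mathsf{v}$. $\mathrm{LP}(\beta,\beta^-)$ has a variable $x_\mathsf{v}\ge 0$ for each $\mathsf{v}\in VP$ and $x_\mathsf{e}\ge 0$ for each $\mathsf{e}\in EP$, and is: maximize $\sum_{\mathsf{e}\in EP,\ \mathsf{e}\in M^*} x_\mathsf{e}$ subject to $\sum_{\mathsf{e}\in H(\mathsf{v})}x_\mathsf{e}=\mathsf{v}_{\deg}\cdot x_\mathsf{v}$ for all $\mathsf{v}\in VP$; $\sum_{\mathsf{e}\in M(\mathsf{v})}x_\mathsf{e}=x_\mathsf{v}$ for all $\mathsf{v}\in VP$ whose $m$-component is true; $\sum_{\mathsf{e}\in M^*(\mathsf{v})}x_\mathsf{e}=x_\mathsf{v}$ for all $\mathsf{v}\in VP$ whose $m^*$-component is true; and $\sum_{\mathsf{e}\in EP,\ \mathsf{e}\in M}x_\mathsf{e}=1$. *)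

(* Defs.v *)
From HB Require Import structures.
From mathcomp Require Import all_boot all_order all_algebra.

Set Implicit Arguments.
Unset Strict Implicit.
Unset Printing Implicit Defensive.

Import Order.TTheory GRing.Theory Num.Theory.

Local Open Scope ring_scope.

Record sgraph (T : finType) := SGraph {
  adj :> rel T;
  adj_sym : symmetric adj;
  adj_irr : irreflexive adj
}.

Section Graphs.
Variable T : finType.
Implicit Types (G H : sgraph T) (M : {set {set T}}).

Definition bipartite G : Prop :=
  exists side : T -> bool, forall u v, G u v -> side u != side v.

Definition deg G (u : T) : nat := #|[set v | G u v]|.

Definition edges G : {set {set T}} :=
  [set [set p.1; p.2] | p in [set p : T * T | G p.1 p.2]].

Definition matching G M : bool := (M \subset edges G) && trivIset M.

Definition mu G : nat := (\max_(M : {set {set T}} | matching G M) #|M|)%N.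

(* A subgraph is taken on the whole vertex set T, i.e. it is a subset of the
   edges; vertices it does not touch have degree 0. *)
Definition EDCS (beta betam : nat) G H : Prop :=
  [/\ subrel H G,
      forall u v, H u v -> (deg H u + deg H v <= beta)%N
    & forall u v, G u v -> ~~ H u v -> (betam <= deg H u + deg H v)%N].

End Graphs.

(* clA = A, clLA = L \ A, clN = N, clRN = R \ N *)
Inductive pos_class := clA | clLA | clN | clRN.

Definition pos_class_code (s : pos_class) : bool * bool :=
  match s with
  | clA => (true, true) | clLA => (true, false)
  | clN => (false, true) | clRN => (false, false)
  end.

Definition pos_class_decode (c : bool * bool) : pos_class :=
  match c with
  | (true, true) => clA | (true, false) => clLA
  | (false, true) => clN | (false, false) => clRN
  end.

Lemma pos_class_codeK : cancel pos_class_code pos_class_decode.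
Proof. by case. Qed.

HB.instance Definition _ := Finite.copy pos_class (can_type pos_class_codeK).

Definition is_left (s : pos_class) : bool := (s == clA) || (s == clLA).
Definition is_right (s : pos_class) : bool := (s == clN) || (s == clRN).

Section Profiles.
Variables beta betam : nat.

(* (s, d, m, m* ) *)
Definition vprofile : finType := (pos_class * 'I_beta * bool * bool)%type.

Definition vcls (v : vprofile) : pos_class := v.1.1.1.
Definition vdeg (v : vprofile) : nat := v.1.1.2.
Definition vM (v : vprofile) : bool := v.1.2.
Definition vMs (v : vprofile) : bool := v.2.

Definition VP : {set vprofile} :=
  [set v | ((vcls v == clN) || (vcls v == clLA) ==> vM v)
           && ((vdeg v == 0%N) ==> ~~ vM v)].

(* (vL, vR, h, m, m* ) *)
Definition eprofile : finType := (vprofile * vprofile * bool * bool * bool)%type.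

Definition eL (e : eprofile) : vprofile := e.1.1.1.1.
Definition eR (e : eprofile) : vprofile := e.1.1.1.2.
Definition eH (e : eprofile) : bool := e.1.1.2.
Definition eM (e : eprofile) : bool := e.1.2.
Definition eMs (e : eprofile) : bool := e.2.

Definition EP : {set eprofile} :=
  [set e |
    [&& (eL e \in VP) && is_left (vcls (eL e)),
        (eR e \in VP) && is_right (vcls (eR e)),
        eH e ==> (vdeg (eL e) != 0%N) && (vdeg (eR e) != 0%N),
        (eM e ==> vM (eL e) && vM (eR e))
          && (eMs e ==> vMs (eL e) && vMs (eR e)),
        eM e ==> eH e,
        eH e || eMs e,
        eH e ==> (vdeg (eL e) + vdeg (eR e) <= beta)%N,
        ~~ eH e ==> (betam <= vdeg (eL e) + vdeg (eR e))%N,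
        eH e ==> ~~ ((vcls (eL e) == clA) && (vcls (eR e) == clRN))
      & eM e ==> (vcls (eR e) == clN) (+) (vcls (eL e) == clLA)]].

Definition at_v (v : vprofile) (e : eprofile) : bool := (eL e == v) || (eR e == v).

Section LP.
Variable R : realFieldType.

(* The values of xv outside VP and of xe outside EP are irrelevant: no
   constraint and no objective term mentions them. *)
Record lp_feasible (xv : vprofile -> R) (xe : eprofile -> R) : Prop := LPFeasible {
  lp_xv_ge0 : forall v, v \in VP -> 0 <= xv v;
  lp_xe_ge0 : forall e, e \in EP -> 0 <= xe e;
  lp_H : forall v, v \in VP ->
    \sum_(e in EP | eH e && at_v v e) xe e = (vdeg v)%:R * xv v;
  lp_M : forall v, v \in VP -> vM v ->
    \sum_(e in EP | eM e && at_v v e) xe e = xv v;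
  lp_Ms : forall v, v \in VP -> vMs v ->
    \sum_(e in EP | eMs e && at_v v e) xe e = xv v;
  lp_norm : \sum_(e in EP | eM e) xe e = 1
}.

Definition lp_objective (xe : eprofile -> R) : R := \sum_(e in EP | eMs e) xe e.

Definition lp_optimal_value (r : R) : Prop :=
  (exists xv xe, lp_feasible xv xe /\ lp_objective xe = r)
  /\ (forall xv xe, lp_feasible xv xe -> lp_objective xe <= r).

End LP.
End Profiles.

(* Main.v *)
(* Upper bound: given an EDCS H of a bipartite graph G, take a maximum matching M
   of H, a maximum matching M* of G and a Koenig vertex cover (L \ A) | N of H of
   size #|M|. Counting the vertices and the edges of H | M* by profile and dividing
   by mu H gives a feasible point of value mu G / mu H.

   Tightness: a feasible objective is bounded, since every M*-edge has an end of
   positive degree and every H-edge has an M-matched end. Hence an optimum is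
   attained at a basic solution; the data being integral, it is rational, and is
   the same over every ordered field. Scale it to integers, read as numbers of
   vertices and edges of each profile. The edges can be distributed among the
   vertices of a profile so that each vertex has the prescribed H-, M- and
   M*-degrees; this gives a multigraph, and a cyclic voltage lift of it is simple.
   In the lift the classes L \ A and N form a vertex cover of H of size #|M|, so
   mu H = #|M|, while mu G >= #|M*|. *)
Require Import Defs.
From HB Require Import structures.
From mathcomp Require Import all_boot all_order all_algebra.
From mathcomp Require Import zify lra.

Set Implicit Arguments.
Unset Strict Implicit.
Unset Printing Implicit Defensive.

Import Order.TTheory GRing.Theory Num.Theory.

(** * Koenig's theorem *)

(** A bipartite multigraph is encoded by a type of edges with two end maps, and a vertex cover by
    its parts on the two sides. The applications take [fst] and [snd] on arcs. *)
Definition cover_pair (I X Y : finType) (f : I -> X) (g : I -> Y)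
    (E : {set I}) (A : {set X}) (B : {set Y}) :=
  [forall e in E, (f e \in A) || (g e \in B)].

Lemma cover_pair_swap (I X Y : finType) (f : I -> X) (g : I -> Y) E A B :
  cover_pair g f E B A = cover_pair f g E A B.
Proof. by apply: eq_forallb => e; rewrite orbC. Qed.

(* If deleting e and deleting e' both lower the cover number, uncrossing the two
   small covers yields one cover of size below k as soon as e, e' share an end. *)
Lemma critical_edges_inj (I X Y : finType) (f : I -> X) (g : I -> Y)
    (E : {set I}) (k : nat) :
  (forall A B, cover_pair f g E A B -> k <= #|A| + #|B|) ->
  (forall e, e \in E -> exists A B,
     cover_pair f g (E :\ e) A B /\ #|A| + #|B| < k) ->
  {in E &, injective f}.
Proof.
move=> covk crit e e' eE e'E fee'; apply/eqP/negPn/negP => ee'.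
have [A [B [/forall_inP cAB ltk]]] := crit _ eE.
have [A' [B' [/forall_inP cAB' ltk']]] := crit _ e'E.
have fA : f e \notin A.
  apply: contraL ltk => fA; rewrite -leqNgt covk //; apply/forall_inP => x xE.
  have [->|xe] := eqVneq x e; first by rewrite fA.
  by apply: cAB; rewrite !inE xe.
have fA' : f e \notin A'.
  apply: contraL ltk' => fA'; rewrite -leqNgt covk //; apply/forall_inP => x xE.
  have [->|xe] := eqVneq x e'; first by rewrite -fee' fA'.
  by apply: cAB'; rewrite !inE xe.
have gB : g e' \in B.
  by have := cAB e'; rewrite !inE eq_sym ee' e'E -fee' (negPf fA) => /(_ isT).
have gB' : g e \in B'.
  by have := cAB' e; rewrite !inE ee' eE (negPf fA') => /(_ isT).
(* The covers in [k1] and [k2] have at most (k-1) + (k-1) + 1 vertices together, the last one being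
   the shared end [f e]; this is less than 2k. *)
have k1 : k <= #|A :&: A'| + #|B :|: B'|.
  apply: covk; apply/forall_inP => x xE; rewrite !inE.
  have [->|xe] := eqVneq x e; first by rewrite gB' !orbT.
  have [->|xe'] := eqVneq x e'; first by rewrite gB !orbT.
  have := cAB x; have := cAB' x; rewrite !inE xe xe' xE => /(_ isT) h /(_ isT).
  by move: h; do 4!case: (_ \in _).
have k2 : k <= #|f e |: (A :|: A')| + #|B :&: B'|.
  apply: covk; apply/forall_inP => x xE; rewrite !inE.
  have [->|xe] := eqVneq x e; first by rewrite eqxx.
  have [->|xe'] := eqVneq x e'; first by rewrite fee' eqxx.
  have := cAB x; have := cAB' x; rewrite !inE xe xe' xE => /(_ isT) h /(_ isT).
  by move: h; do 4!case: (_ \in _); rewrite /= ?orbT.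
have := cardsU1 (f e) (A :|: A'); have := cardsUI A A'; have := cardsUI B B'.
by case: (_ \notin _) => /=; lia.
Qed.

(** Induction on the number of edges: an edge whose deletion keeps every cover at size at least [k]
    is dropped. If no such edge is left, [critical_edges_inj] on both sides makes [E] itself a
    matching, and [f @: E] is a cover of it. *)
Lemma koenig_matching (I X Y : finType) (f : I -> X) (g : I -> Y)
    (E : {set I}) (k : nat) :
  (forall A B, cover_pair f g E A B -> k <= #|A| + #|B|) ->
  exists M : {set I}, [/\ M \subset E, {in M &, injective f},
                          {in M &, injective g} & k <= #|M|].
Proof.
have [s] := ubnP #|E|; elim: s E => // s IHs E ltE covk.
have [/exists_inP[e eE /forallP nc]|/exists_inPn crit] := boolP [exists e in E,
    [forall C : {set X} * {set Y}, cover_pair f g (E :\ e) C.1 C.2 ==>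
       (k <= #|C.1| + #|C.2|)]].
  have [||M [ME fM gM kM]] := IHs (E :\ e).
  - by rewrite (cardsD1 e) eE in ltE.
  - by move=> A B cAB; have := nc (A, B); rewrite cAB.
  by exists M; split=> //; apply: subset_trans ME (subsetDl _ _).
have {}crit e : e \in E -> exists A B,
    cover_pair f g (E :\ e) A B /\ #|A| + #|B| < k.
  move/crit => /forallPn[[A B]]; rewrite negb_imply -ltnNge => /andP[cAB lt].
  by exists A, B.
exists E; split=> //.
- exact: critical_edges_inj covk crit.
- apply: (@critical_edges_inj _ _ _ g f E k) => [A B|e /crit[A [B [cAB lt]]]].
    by rewrite cover_pair_swap addnC; apply: covk.
  by exists B, A; rewrite cover_pair_swap addnC.
- apply: leq_trans (covk (f @: E) set0 _) _; last first.
    by rewrite cards0 addn0 leq_imset_card.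
  by apply/forall_inP => e eE; rewrite imset_f.
Qed.

(** A cover vertex meets at most one edge of [M]; the last identity is inclusion-exclusion over the
    two ends. *)
Lemma matching_le_cover (I X Y : finType) (f : I -> X) (g : I -> Y)
    (E M : {set I}) (A : {set X}) (B : {set Y}) :
  M \subset E -> {in M &, injective f} -> {in M &, injective g} ->
  cover_pair f g E A B ->
  #|[set e in M | f e \in A]| <= #|A| /\ #|[set e in M | g e \in B]| <= #|B|
  /\ #|M| + #|[set e in M | (f e \in A) && (g e \in B)]|
     = #|[set e in M | f e \in A]| + #|[set e in M | g e \in B]|.
Proof.
move=> ME fM gM /forall_inP cAB; split; [|split].
- rewrite -(card_in_imset (f := f)) => [|x y]; last first.
    by rewrite !inE => /andP[xM _] /andP[yM _]; apply: fM.
  by apply/subset_leq_card/subsetP => x /imsetP[e]; rewrite inE => /andP[_ ?] ->.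
- rewrite -(card_in_imset (f := g)) => [|x y]; last first.
    by rewrite !inE => /andP[xM _] /andP[yM _]; apply: gM.
  by apply/subset_leq_card/subsetP => x /imsetP[e]; rewrite inE => /andP[_ ?] ->.
- rewrite -[RHS]cardsUI; congr (_ + _); apply: eq_card => e; rewrite !inE.
    rewrite -andb_orr; case eM: (e \in M) => //=.
    by rewrite cAB // (subsetP ME).
  by case: (e \in M).
Qed.

Lemma koenig (I X Y : finType) (f : I -> X) (g : I -> Y) (E : {set I}) :
  exists (M : {set I}) (A : {set X}) (B : {set Y}),
  [/\ M \subset E, {in M &, injective f}, {in M &, injective g},
      cover_pair f g E A B & #|M| = #|A| + #|B|].
Proof.
pose C0 : {set X} * {set Y} := (setT, set0).
have c0 : cover_pair f g E C0.1 C0.2 by apply/forall_inP => e _ /=; rewrite inE.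
case: (@arg_minnP _ C0 (fun C => cover_pair f g E C.1 C.2)
   (fun C : {set X} * {set Y} => #|C.1| + #|C.2|) c0) => -[A B] /= cAB mn.
have [|M [ME fM gM kM]] := @koenig_matching _ _ _ f g E (#|A| + #|B|).
  by move=> A' B' c'; apply: (mn (A', B')).
exists M, A, B; split=> //; apply/eqP; rewrite eqn_leq kM andbT.
have [leA [leB cM]] := matching_le_cover ME fM gM cAB.
lia.
Qed.

(** Complementary slackness: equal sizes turn every inequality of [matching_le_cover] into an
    equality. The conclusions become the validity conditions that tie [M] to the position
    classes. *)
Lemma koenig_tight (I X Y : finType) (f : I -> X) (g : I -> Y)
    (E M : {set I}) (A : {set X}) (B : {set Y}) :
  M \subset E -> {in M &, injective f} -> {in M &, injective g} ->
  cover_pair f g E A B -> #|M| = #|A| + #|B| ->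
  [/\ {subset A <= f @: M}, {subset B <= g @: M}
    & {in M, forall e, (g e \in B) (+) (f e \in A)}].
Proof.
move=> ME fM gM cAB cM; have [leA [leB cE]] := matching_le_cover ME fM gM cAB.
have eqA : #|[set e in M | f e \in A]| = #|A| by lia.
have eqB : #|[set e in M | g e \in B]| = #|B| by lia.
have c0 : #|[set e in M | (f e \in A) && (g e \in B)]| = 0 by lia.
have sub (Z : finType) (h : I -> Z) (C : {set Z}) : {in M &, injective h} ->
    #|[set e in M | h e \in C]| = #|C| -> {subset C <= h @: M}.
  move=> hM eqC x xC.
  have /eqP CE : h @: [set e in M | h e \in C] == C.
    rewrite eqEcard card_in_imset ?eqC ?leqnn ?andbT => [|u v]; last first.
      by rewrite !inE => /andP[uM _] /andP[vM _]; apply: hM.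
    by apply/subsetP => z /imsetP[e]; rewrite inE => /andP[_ ?] ->.
  move: xC; rewrite -CE => /imsetP[e]; rewrite inE => /andP[eM _] ->.
  exact: imset_f.
split; [exact: sub|exact: sub|move=> e eM].
move/eqP: c0; rewrite cards_eq0 => /eqP/setP/(_ e); rewrite !inE eM /=.
move/forall_inP: cAB => /(_ e (subsetP ME _ eM)).
by do 2!case: (_ \in _).
Qed.

(** * Matchings as sets of arcs *)

Section OrientedMatchings.
Variable T : finType.
Implicit Types (G H : sgraph T) (M D : {set T * T}) (side : T -> bool).

Definition omatching D M :=
  [/\ M \subset D, {in M &, injective fst} & {in M &, injective snd}].

Definition arcs G side : {set T * T} := [set p | G p.1 p.2 && side p.1].

Lemma set2_side_inj side (a b c d : T) :
  side a -> ~~ side b -> side c -> ~~ side d ->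
  [set a; b] = [set c; d] -> a = c /\ b = d.
Proof.
move=> sa sb sc sd eqs; split.
  have : a \in [set c; d] by rewrite -eqs !inE eqxx.
  by rewrite !inE => /orP[/eqP //|/eqP ad]; rewrite -ad sa in sd.
have : b \in [set c; d] by rewrite -eqs !inE eqxx orbT.
by rewrite !inE => /orP[/eqP bc|/eqP //]; rewrite bc sc in sb.
Qed.

Lemma arcs_side G side p :
  (forall u v, G u v -> side u != side v) -> p \in arcs G side ->
  [/\ G p.1 p.2, side p.1 & ~~ side p.2].
Proof.
move=> bip; rewrite inE => /andP[Gp sp]; split=> //.
by have := bip _ _ Gp; rewrite sp; case: (side p.2).
Qed.

(** The side of a vertex determines the orientation of its edges, so forgetting orientation is
    injective on arcs, and a tail never equals a head. *)
Lemma omatching_le_mu G side M :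
  (forall u v, G u v -> side u != side v) ->
  omatching (arcs G side) M -> #|M| <= mu G.
Proof.
move=> bip [MG M1 M2].
have arcP p : p \in M -> [/\ G p.1 p.2, side p.1 & ~~ side p.2].
  by move/(subsetP MG)/(arcs_side bip).
have injM : {in M &, injective (fun p => [set p.1; p.2])}.
  move=> p q /arcP[_ sp1 sp2] /arcP[_ sq1 sq2] /(set2_side_inj sp1 sp2 sq1 sq2).
  by case: p q {sp1 sp2 sq1 sq2} => [a b] [c d] /= [-> ->].
rewrite -(card_in_imset injM) /mu.
apply: (@leq_bigmax_cond _ _ (fun M : {set {set T}} => #|M|)).
apply/andP; split.
  apply/subsetP => _ /imsetP[p /arcP[Gp _ _] ->].
  by apply/imsetP; exists p; rewrite ?inE.
apply/trivIsetP => _ _ /imsetP[p pM ->] /imsetP[q qM ->] pq.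
rewrite -setI_eq0; apply: contraNT pq => /set0Pn[x].
have [_ sp1 sp2] := arcP p pM; have [_ sq1 sq2] := arcP q qM.
rewrite !inE => /andP[/orP[]/eqP-> /orP[]/eqP] e; apply/eqP.
- by rewrite (M1 p q).
- by rewrite -e sp1 in sq2.
- by rewrite e sq1 in sp2.
- by rewrite (M2 p q).
Qed.

Lemma mu_omatching G side :
  (forall u v, G u v -> side u != side v) ->
  exists2 M, omatching (arcs G side) M & mu G <= #|M|.
Proof.
move=> bip.
have [N /andP[NG tN] muE] : {N | matching G N & mu G = #|N|}.
  apply: (eq_bigmax_cond (fun N : {set {set T}} => #|N|)).
  apply/card_gt0P; exists set0; rewrite unfold_in /matching sub0set /=.
  by apply/trivIsetP => A B; rewrite inE.
set M := [set p in arcs G side | [set p.1; p.2] \in N].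
have eqM p q x : p \in M -> q \in M -> x \in [set p.1; p.2] ->
    x \in [set q.1; q.2] -> p = q.
  rewrite [p \in M]in_set [q \in M]in_set => /andP[pG pN] /andP[qG qN] xp xq.
  have [_ sp1 sp2] := arcs_side bip pG; have [_ sq1 sq2] := arcs_side bip qG.
  have [|ne] := eqVneq [set p.1; p.2] [set q.1; q.2].
    case/(set2_side_inj sp1 sp2 sq1 sq2).
    by case: p q {pG pN qG qN xp xq sp1 sp2 sq1 sq2} => [a b] [c d] /= -> ->.
  have := trivIsetP tN _ _ pN qN ne; rewrite -setI_eq0 => /eqP/setP/(_ x).
  by rewrite in_setI xp xq in_set0.
exists M.
  split; first by apply/subsetP => p; rewrite inE => /andP[].
    by move=> p q pM qM pq; apply: (eqM p q p.1) => //; rewrite ?pq !inE eqxx.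
  by move=> p q pM qM pq; apply: (eqM p q p.2) => //; rewrite ?pq !inE eqxx orbT.
rewrite muE; apply: leq_trans (leq_imset_card (fun p : T * T => [set p.1; p.2]) _).
apply/subset_leq_card/subsetP => s sN.
have /imsetP[p] := subsetP NG _ sN; rewrite inE => Gp sE.
have [sp|sp] := boolP (side p.1).
  by apply/imsetP; exists p; rewrite // !inE Gp sp -sE.
apply/imsetP; exists (p.2, p.1); rewrite ?inE /= setUC -?sE ?sN ?andbT //.
rewrite adj_sym Gp /=.
by have := bip _ _ Gp; rewrite (negPf sp); case: (side p.2).
Qed.

Lemma mu_le_cover G side A B :
  (forall u v, G u v -> side u != side v) ->
  cover_pair fst snd (arcs G side) A B -> mu G <= #|A| + #|B|.
Proof.
move=> bip cAB; have [M [MG M1 M2] leM] := mu_omatching bip.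
have [leA [leB cM]] := matching_le_cover MG M1 M2 cAB.
lia.
Qed.

(** A degree for arbitrary arc sets, so that [H], [M] and [M*] obey one and the same counting
    rule. *)
Definition adeg D u : nat :=
  #|[set p in D | p.1 == u]| + #|[set p in D | p.2 == u]|.

Lemma adegE G side D u : (forall u v, G u v -> side u != side v) ->
  D \subset arcs G side ->
  adeg D u = if side u then #|[set p in D | p.1 == u]|
             else #|[set p in D | p.2 == u]|.
Proof.
move=> bip /subsetP DG; rewrite /adeg; case: ifP => su.
  rewrite [X in _ + X](_ : _ = 0) ?addn0 //; apply/eqP; rewrite cards_eq0.
  apply/eqP/setP => p; rewrite !inE; apply/negP.
  by move=> /andP[/DG/(arcs_side bip)[_ _ sp]] /eqP pu; rewrite pu su in sp.
rewrite [X in X + _](_ : _ = 0) //; apply/eqP; rewrite cards_eq0.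
apply/eqP/setP => p; rewrite !inE; apply/negP.
by move=> /andP[/DG/(arcs_side bip)[_ sp _]] /eqP pu; rewrite pu su in sp.
Qed.

Lemma adeg_arcs G side u : (forall u v, G u v -> side u != side v) ->
  adeg (arcs G side) u = deg G u.
Proof.
move=> bip; rewrite (adegE u bip) // /deg; case: ifP => su.
  rewrite -[RHS](card_imset (f := fun w => (u, w))) => [|x y []] //.
  apply: eq_card => -[a b]; apply/idP/imsetP => [|[w]]; rewrite !inE /=.
    by case/andP => /andP[Gab _] /eqP <-; exists b; rewrite ?inE.
  by move=> Guw [-> ->]; rewrite Guw su eqxx.
rewrite -[RHS](card_imset (f := fun w => (w, u))) => [|x y []] //.
apply: eq_card => -[a b]; apply/idP/imsetP => [|[w]]; rewrite !inE /=.
  by case/andP => /andP[Gab _] /eqP <-; exists a; rewrite ?inE // adj_sym.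
move=> Guw [-> ->]; rewrite eqxx adj_sym Guw /= andbT.
by have := bip _ _ Guw; rewrite su; case: (side w).
Qed.

Definition matched M u := (u \in fst @: M) || (u \in snd @: M).

Lemma card_fiber_inj M (f : T * T -> T) u :
  {in M &, injective f} -> #|[set p in M | f p == u]| = (u \in f @: M).
Proof.
move=> fM; case: imsetP => [[p pM ->]|nu] /=.
  rewrite (_ : [set _ in _ | _] = [set p]) ?cards1 //; apply/setP => q.
  rewrite !inE; apply/andP/eqP => [[qM /eqP]|-> //]; exact: fM.
apply/eqP; rewrite cards_eq0; apply/eqP/setP => p; rewrite !inE.
by apply/negP => /andP[pM /eqP pu]; apply: nu; exists p.
Qed.

Lemma adeg_matching G side M u : (forall u v, G u v -> side u != side v) ->
  omatching (arcs G side) M -> adeg M u = matched M u.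
Proof.
move=> bip [MG M1 M2]; have := adegE u bip MG; rewrite /adeg !card_fiber_inj //.
by rewrite /matched; case: ifP => _; case: (_ \in _); case: (_ \in _).
Qed.

Lemma adeg_gt0 D p : p \in D -> 0 < adeg D p.1 /\ 0 < adeg D p.2.
Proof.
move=> pD; rewrite /adeg !addn_gt0; split; apply/orP; [left|right];
by apply/card_gt0P; exists p; rewrite inE pD eqxx.
Qed.

End OrientedMatchings.

Local Open Scope ring_scope.

(** * Rational optima of linear programs *)

Section BasicSolutions.
Variables m n : nat.

Definition std_feasible (F : realFieldType) (A : 'M[F]_(m, n)) (b : 'rV_n)
    (x : 'rV_m) := (x *m A == b) && [forall i, 0 <= x 0 i].

Definition supp (F : realFieldType) (x : 'rV[F]_m) := [set i | x 0 i != 0].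

Definition out_mx (F : realFieldType) (S : {set 'I_m}) : 'M[F]_m :=
  diag_mx (\row_i (i \notin S)%:R).

(* Row-free iff the rows of A indexed by S are independent. Unknowns are row
   vectors x with x *m A = b, so the rows of A play the role of LP columns. *)
Definition basic_mx (F : realFieldType) (A : 'M[F]_(m, n)) S :=
  row_mx A (out_mx F S).

Definition basic_sol (F : realFieldType) (A : 'M[F]_(m, n)) (b : 'rV_n) S :=
  row_mx b (0 : 'rV_m) *m pinvmx (basic_mx A S).

Lemma mul_out_mx_eq0 (F : realFieldType) (x : 'rV[F]_m) S :
  (x *m out_mx F S == 0) = (supp x \subset S).
Proof.
rewrite mul_mx_diag; apply/eqP/subsetP => [x0 i|xS].
  rewrite inE => xi; move/matrixP/(_ 0 i): x0; rewrite !mxE.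
  by move/eqP; rewrite mulf_eq0 (negPf xi) pnatr_eq0 eqb0 negbK.
apply/rowP => i; rewrite !mxE; have [->|xi] := eqVneq (x 0 i) 0.
  by rewrite mul0r.
by rewrite xS ?inE // mulr0.
Qed.

(** Dependent rows give a kernel direction supported in [supp x]. Moving along it without lowering
    the objective, up to the first coordinate that vanishes, shrinks the support. *)
Lemma std_feasible_improve (F : realFieldType) (A : 'M[F]_(m, n)) (b : 'rV_n)
    (c : 'cV_m) (C : F) (x : 'rV_m) :
  (forall y, std_feasible A b y -> (y *m c) 0 0 <= C) ->
  std_feasible A b x -> ~~ row_free (basic_mx A (supp x)) ->
  exists y, [/\ std_feasible A b y, (x *m c) 0 0 <= (y *m c) 0 0
                & supp y \proper supp x].
Proof.
move=> bnd fx.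
rewrite -kermx_eq0 => /rowV0Pn[z zker z0].
move/sub_kermxP: zker; rewrite mul_mx_row -row_mx0.
case/eq_row_mx => zA /eqP; rewrite mul_out_mx_eq0 => zx.
case/andP: (fx) => /eqP xA /forallP x_ge0.
have feasD t (w : 'rV_m) : w *m A = 0 -> (forall i, 0 <= x 0 i + t * w 0 i) ->
    std_feasible A b (x + t *: w).
  move=> wA w_ge0; rewrite /std_feasible mulmxDl -scalemxAl wA scaler0 addr0 xA.
  by rewrite eqxx; apply/forallP => i; rewrite !mxE.
have objD t (w : 'rV_m) :
    ((x + t *: w) *m c) 0 0 = (x *m c) 0 0 + t * (w *m c) 0 0.
  by rewrite mulmxDl -scalemxAl !mxE.
(* Up to sign [z] does not lower the objective. If it has no negative coordinate, then either the
   objective is constant along it and [- z] serves, or the ray along [z] is feasible and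
   unbounded. *)
have {z z0 zA zx} [w [wA wx cw_ge0 [i wi]]] : exists w : 'rV_m,
    [/\ w *m A = 0, supp w \subset supp x, 0 <= (w *m c) 0 0
      & exists i, w 0 i < 0].
  wlog cz : z z0 zA zx / 0 <= (z *m c) 0 0.
    move=> wl; have [|/ltW cz] := leP 0 ((z *m c) 0 0); first exact: wl.
    apply: (wl (- z)); rewrite ?oppr_eq0 ?mulNmx ?zA ?oppr0 // ?mxE ?oppr_ge0 //.
      apply: subset_trans zx; apply/subsetP => i.
      by rewrite !inE mxE oppr_eq0.
    by move: cz; rewrite mxE.
  have [/existsP[i zi]|/existsPn z_ge0] := boolP [exists i, z 0 i < 0].
    by exists z; split=> //; exists i.
  have {}z_ge0 i : 0 <= z 0 i by rewrite leNgt z_ge0.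
  have [i zi] : exists i, z 0 i != 0.
    apply/existsP; apply: contraR z0 => /existsPn z0.
    by apply/eqP/rowP => i; rewrite mxE; apply/eqP/negPn.
  have [cz0|cz_gt0] := eqVneq ((z *m c) 0 0) 0.
    exists (- z); split.
    - by rewrite mulNmx zA oppr0.
    - apply: subset_trans zx; apply/subsetP => j.
      by rewrite !inE mxE oppr_eq0.
    - by rewrite mulNmx mxE cz0 oppr0.
    - by exists i; rewrite mxE oppr_lt0 lt_def zi z_ge0.
  have {}cz_gt0 : 0 < (z *m c) 0 0 by rewrite lt_def cz_gt0.
  have xC := bnd _ fx.
  (* This step length brings the objective to [C + 1], against the bound. *)
  pose t := (C - (x *m c) 0 0 + 1) / (z *m c) 0 0.
  have t_ge0 : 0 <= t by rewrite divr_ge0 // addr_ge0 ?subr_ge0.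
  have /bnd : std_feasible A b (x + t *: z).
    by apply: feasD => // j; rewrite addr_ge0 // mulr_ge0.
  rewrite objD divfK ?gt_eqF // => leC; exfalso; clear - leC; lra.
(* Ratio test: [k] is a coordinate that reaches zero first. *)
case: (@Order.TotalTheory.arg_minP _ _ _ i (fun i => w 0 i < 0)
  (fun i => x 0 i / - w 0 i) wi) => k wk kmin.
pose t := x 0 k / - w 0 k.
have t_ge0 : 0 <= t by rewrite divr_ge0 // oppr_ge0 ltW.
have supp_w j : x 0 j = 0 -> w 0 j = 0.
  move=> xj; apply/eqP; apply/negPn/negP => wj.
  by move/subsetP/(_ j): wx; rewrite !inE wj xj eqxx => /(_ isT).
exists (x + t *: w); split.
- apply: feasD => // j; have [wj|wj] := leP 0 (w 0 j).
    by rewrite addr_ge0 // mulr_ge0.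
  have := kmin _ wj; rewrite -/t ler_pdivlMr ?oppr_gt0 //.
  by rewrite mulrN -subr_ge0 opprK.
- by rewrite objD lerDl mulr_ge0.
- apply/properP; split.
    apply/subsetP => j; rewrite !inE !mxE; apply: contra => /eqP xj.
    by rewrite xj supp_w // mulr0 addr0.
  exists k; rewrite !inE.
    by apply/eqP => /supp_w wk0; rewrite wk0 ltxx in wk.
  rewrite !mxE negbK /t invrN mulrN mulNr divfK ?subrr //.
  by rewrite lt_eqF.
Qed.

Lemma std_feasible_basic (F : realFieldType) (A : 'M[F]_(m, n)) (b : 'rV_n)
    (c : 'cV_m) (C : F) (x : 'rV_m) :
  (forall y, std_feasible A b y -> (y *m c) 0 0 <= C) ->
  std_feasible A b x ->
  exists y, [/\ std_feasible A b y, (x *m c) 0 0 <= (y *m c) 0 0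
                & row_free (basic_mx A (supp y))].
Proof.
move=> bnd; have [k] := ubnP #|supp x|; elim: k x => // k IHk x xk fx.
have [fr|nfr] := boolP (row_free (basic_mx A (supp x))); first by exists x.
have [y [fy xy /proper_card ltyx]] := std_feasible_improve bnd fx nfr.
have [|z [fz yz frz]] := IHk y _ fy; first exact: leq_trans ltyx _.
by exists z; split=> //; apply: le_trans yz.
Qed.

(** The second block of [basic_mx] vanishes on [x], and for a row-free matrix [pinvmx] is a right
    inverse, so [x] can be recovered from its support alone. *)
Lemma basic_solE (F : realFieldType) (A : 'M[F]_(m, n)) (b x : 'rV_ _) :
  x *m A = b -> row_free (basic_mx A (supp x)) -> x = basic_sol A b (supp x).
Proof.
move=> xA fr; rewrite /basic_sol -[LHS](mulmxKp fr); congr (_ *m _).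
rewrite mul_mx_row xA; congr row_mx; apply/eqP.
by rewrite mul_out_mx_eq0.
Qed.

(** This brings rationality: with rational data, a basic solution over [F] is the image of the
    rational one with the same support. *)
Lemma map_basic_sol (F K : realFieldType) (f : {rmorphism F -> K})
    (A : 'M[F]_(m, n)) (b : 'rV_n) S :
  map_mx f (basic_sol A b S) = basic_sol (map_mx f A) (map_mx f b) S.
Proof.
rewrite /basic_sol map_mxM map_row_mx raddf0 map_pinvmx map_row_mx.
congr (_ *m pinvmx (row_mx _ _)); apply/matrixP => i j; rewrite !mxE.
by rewrite rmorphMn /= rmorph_nat.
Qed.

Lemma std_feasible_ratr (F : realFieldType) (A : 'M[rat]_(m, n)) b x :
  std_feasible (map_mx (ratr : rat -> F) A) (map_mx ratr b) (map_mx ratr x)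
  = std_feasible A b x.
Proof.
rewrite /std_feasible -map_mxM (inj_eq (@map_mx_inj _ _ _ _ _)).
by congr andb; apply: eq_forallb => i; rewrite mxE ler0q.
Qed.

(** Every feasible point is dominated by a basic one, and there are only finitely many supports [S];
    the best feasible basic solution is selected over [rat]. *)
Lemma std_rational_optimum (F : realFieldType) (A : 'M[rat]_(m, n))
    (b : 'rV_n) (c : 'cV_m) (C : F) (x0 : 'rV[F]_m) :
  let AF := map_mx ratr A in
  let bF := map_mx ratr b in
  let cF := map_mx ratr c in
  (forall y, std_feasible AF bF y -> (y *m cF) 0 0 <= C) ->
  std_feasible AF bF x0 ->
  exists2 x, std_feasible A b x &
    forall y, std_feasible AF bF y -> (y *m cF) 0 0 <= ratr ((x *m c) 0 0).
Proof.
move=> AF bF cF bnd fx0.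
have obj S : ((map_mx ratr (basic_sol A b S)) *m cF) 0 0
             = ratr ((basic_sol A b S *m c) 0 0).
  by rewrite -map_mxM mxE.
have basicP y : std_feasible AF bF y -> exists2 S,
    std_feasible A b (basic_sol A b S) &
    (y *m cF) 0 0 <= ratr ((basic_sol A b S *m c) 0 0).
  move=> fy; have [z [fz yz frz]] := std_feasible_basic bnd fy.
  case/andP: (fz) => /eqP zA _; have zE := basic_solE zA frz.
  exists (supp z); first by rewrite -(std_feasible_ratr F) map_basic_sol -zE.
  by rewrite -obj map_basic_sol -zE.
have [S0 fS0 _] := basicP _ fx0.
case: (@Order.TotalTheory.arg_maxP _ _ _ S0
  (fun S => std_feasible A b (basic_sol A b S))
  (fun S => (basic_sol A b S *m c) 0 0) fS0) => S fS Smax.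
exists (basic_sol A b S) => // y /basicP[S' fS' yS'].
by apply: le_trans yS' _; rewrite ler_rat; apply: Smax.
Qed.

End BasicSolutions.

(** * Linear programs with integer data over finite index types *)

Section IndexedLP.
Variables (I J : finType) (a : I -> J -> int) (b : J -> int) (c : I -> int).

Definition ilp_feasible (F : realFieldType) (x : I -> F) :=
  (forall i, 0 <= x i) /\ (forall j, \sum_i x i * (a i j)%:~R = (b j)%:~R).

Definition ilp_obj (F : realFieldType) (x : I -> F) := \sum_i x i * (c i)%:~R.

Let amx (F : realFieldType) : 'M[F]_(#|I|, #|J|) :=
  \matrix_(i, j) (a (enum_val i) (enum_val j))%:~R.
Let bmx (F : realFieldType) : 'rV[F]_#|J| := \row_j (b (enum_val j))%:~R.
Let cmx (F : realFieldType) : 'cV[F]_#|I| := \col_i (c (enum_val i))%:~R.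

Lemma ilp_std_feasible (F : realFieldType) (x : 'rV[F]_#|I|) :
  std_feasible (amx F) (bmx F) x -> ilp_feasible (fun i => x 0 (enum_rank i)).
Proof.
case/andP => /eqP/rowP xA /forallP x_ge0; split=> // j.
have := xA (enum_rank j); rewrite !mxE enum_rankK => <-.
rewrite (reindex _ (onW_bij _ (enum_val_bij I))) /=.
by apply: eq_bigr => i _; rewrite enum_valK mxE enum_rankK.
Qed.

Lemma std_ilp_feasible (F : realFieldType) (x : I -> F) :
  ilp_feasible x -> std_feasible (amx F) (bmx F) (\row_i x (enum_val i)).
Proof.
case=> x_ge0 xA; apply/andP; split; last by apply/forallP => i; rewrite mxE.
apply/eqP/rowP => j; rewrite !mxE -xA.
rewrite (reindex _ (onW_bij _ (enum_val_bij I))) /=.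
by apply: eq_bigr => i _; rewrite !mxE.
Qed.

Lemma std_ilp_obj (F : realFieldType) (x : 'rV[F]_#|I|) :
  (x *m cmx F) 0 0 = ilp_obj (fun i => x 0 (enum_rank i)).
Proof.
rewrite mxE /ilp_obj (reindex _ (onW_bij _ (enum_val_bij I))) /=.
by apply: eq_bigr => i _; rewrite enum_valK mxE.
Qed.

Lemma ilp_rational_optimum (F : realFieldType) (C : F) (x0 : I -> F) :
  (forall y : I -> F, ilp_feasible y -> ilp_obj y <= C) ->
  ilp_feasible x0 ->
  exists2 x : I -> rat, ilp_feasible x &
    forall y : I -> F, ilp_feasible y -> ilp_obj y <= ratr (ilp_obj x).
Proof.
move=> bnd fx0.
have aE : amx F = map_mx ratr (amx rat).
  by apply/matrixP => i j; rewrite !mxE ratr_int.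
have bE : bmx F = map_mx ratr (bmx rat).
  by apply/matrixP => i j; rewrite !mxE ratr_int.
have cE : cmx F = map_mx ratr (cmx rat).
  by apply/matrixP => i j; rewrite !mxE ratr_int.
have [||x fx xmax] := @std_rational_optimum _ _ F (amx rat) (bmx rat) (cmx rat) C
    (\row_i x0 (enum_val i)) _ _.
- move=> y; rewrite -aE -bE -cE std_ilp_obj => /ilp_std_feasible; exact: bnd.
- by rewrite -aE -bE; apply: std_ilp_feasible.
exists (fun i => x 0 (enum_rank i)); first exact: ilp_std_feasible.
move=> y /std_ilp_feasible; rewrite aE bE => /xmax; rewrite -cE !std_ilp_obj.
by congr (_ <= _); apply: eq_bigr => i _; rewrite mxE enum_rankK.
Qed.

End IndexedLP.

(** * The factor-revealing program *)

Section ProfileLP.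
Variables beta betam : nat.
Notation VP := (VP beta).
Notation EP := (EP beta betam).
Implicit Types (v : vprofile beta) (e : eprofile beta) (k : option bool).

(* The three families of degree constraints, indexed by None for H, Some true
   for M and Some false for M*. When vM v (resp. vMs v) fails, the uniform
   constraint [lp_kind] below reads 0 = 0 by validity of edge profiles. *)
Definition flag k e := match k with
  | None => eH e | Some true => eM e | Some false => eMs e end.

Definition wt k v : nat := match k with
  | None => vdeg v | Some true => vM v | Some false => vMs v end.

Record ep_valid e : Prop := EPValid {
  ep_L : eL e \in VP;
  ep_left : Defs.is_left (vcls (eL e));
  ep_R : eR e \in VP;
  ep_right : Defs.is_right (vcls (eR e));
  ep_Hdeg : eH e -> vdeg (eL e) != 0%N /\ vdeg (eR e) != 0%N;
  ep_vM : eM e -> vM (eL e) /\ vM (eR e);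
  ep_vMs : eMs e -> vMs (eL e) /\ vMs (eR e);
  ep_MH : eM e -> eH e;
  ep_HMs : eH e || eMs e;
  ep_le : eH e -> (vdeg (eL e) + vdeg (eR e) <= beta)%N;
  ep_ge : ~~ eH e -> (betam <= vdeg (eL e) + vdeg (eR e))%N;
  ep_cover : eH e -> ~~ ((vcls (eL e) == clA) && (vcls (eR e) == clRN));
  ep_exact : eM e -> (vcls (eR e) == clN) (+) (vcls (eL e) == clLA)
}.

Lemma EPP e : reflect (ep_valid e) (e \in EP).
Proof.
rewrite inE; apply: (iffP idP).
  case/andP=> /andP[? ?] /andP[/andP[? ?]] /andP[/implyP h1].
  case/andP=> /andP[/implyP h2 /implyP h3] /andP[/implyP ?] /andP[?].
  case/andP=> /implyP ? /andP[/implyP ?] /andP[/implyP ? /implyP ?].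
  by split=> //; [move/h1|move/h2|move/h3]; move/andP.
case=> -> -> -> -> h1 h2 h3 h4 -> h6 h7 h8 h9 /=.
apply/and5P; split; first by apply/implyP => /h1[-> ->].
- by apply/andP; split; apply/implyP; [case/h2=> -> ->|case/h3=> -> ->].
- exact/implyP.
- exact/implyP.
- by apply/and3P; split; apply/implyP.
Qed.

(** As an [H]-edge never joins A to R \ N, it has an end in L \ A or in N, and valid profiles of
    these classes are matched. *)
Lemma ep_cover_vM e : e \in EP -> eH e -> vM (eL e) || vM (eR e).
Proof.
move/EPP => ve He; have := ep_cover ve He; have := ep_L ve; have := ep_R ve.
have := ep_left ve; have := ep_right ve; rewrite !inE /Defs.is_left /Defs.is_right.
by case: (vcls (eL e)) => //=; case: (vcls (eR e)) => //= _ _;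
  case: (vM (eL e)); case: (vM (eR e)).
Qed.

Lemma flag_wt_gt0 k e : e \in EP -> flag k e ->
  (0 < wt k (eL e))%N /\ (0 < wt k (eR e))%N.
Proof.
by move/EPP => ve; case: k => [[]|] /= => [/(ep_vM ve)|/(ep_vMs ve)|/(ep_Hdeg ve)];
  rewrite -?lt0n // => -[-> ->].
Qed.

(** Left and right classes are disjoint, so the two alternatives never hold together. *)
Lemma at_vE v e : e \in EP -> (at_v v e : nat) = ((eL e == v) + (eR e == v))%N.
Proof.
move/EPP => ve; rewrite /at_v; case: eqP => [eLv|] //=; case: eqP => // eRv.
have := ep_left ve; have := ep_right ve; rewrite eLv eRv /Defs.is_left /Defs.is_right.
by case: (vcls v).
Qed.

Section Feasible.
Variable R : realFieldType.
Implicit Types (xv : vprofile beta -> R) (xe : eprofile beta -> R).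

Lemma sum_at_v xe k v :
  \sum_(e in EP | flag k e && at_v v e) xe e =
  \sum_(e in EP | flag k e && (eL e == v)) xe e +
  \sum_(e in EP | flag k e && (eR e == v)) xe e.
Proof.
rewrite big_mkcond [in RHS]big_mkcond [X in _ = _ + X]big_mkcond -big_split.
apply: eq_bigr => e _ /=; have [/(at_vE v)|] := boolP (e \in EP); last first.
  by rewrite /= addr0.
case: (flag k e) => /=; last by rewrite addr0.
by case: at_v; case: (eL e == v); case: (eR e == v); rewrite ?addr0 ?add0r.
Qed.

Lemma lp_kind xv xe : lp_feasible betam xv xe -> forall k v, v \in VP ->
  \sum_(e in EP | flag k e && at_v v e) xe e = (wt k v)%:R * xv v.
Proof.
move=> fx k v vVP; case: k => [b|]; last exact: (lp_H fx).
have [wk|] := boolP (0 < wt (Some b) v)%N.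
  case: b wk => /= wk; rewrite ?(lp_M fx) ?(lp_Ms fx) //; move: wk;
  by case: (_ v) => //=; rewrite mul1r.
rewrite -eqn0Ngt => /eqP w0; rewrite w0 mul0r big1 // => e /and3P[eEP fe].
have [wL wR] := flag_wt_gt0 eEP fe.
by move=> /orP[] /eqP ev; rewrite ev w0 in wL wR.
Qed.

Lemma lp_feasibleI xv xe :
  (forall v, v \in VP -> 0 <= xv v) -> (forall e, e \in EP -> 0 <= xe e) ->
  (forall k v, v \in VP ->
     \sum_(e in EP | flag k e && at_v v e) xe e = (wt k v)%:R * xv v) ->
  \sum_(e in EP | eM e) xe e = 1 -> lp_feasible betam xv xe.
Proof.
move=> v0 e0 kE n1; split=> // [v vVP|v vVP vm|v vVP vm].
- exact: (kE None).
- by rewrite (kE (Some true)) //= vm mul1r.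
- by rewrite (kE (Some false)) //= vm mul1r.
Qed.

(** Double counting: the degree constraints are summed over the profiles in [P], and each edge
    contributes once for each end in [P]. *)
Lemma sum_wt xv xe (P : pred (vprofile beta)) k :
  lp_feasible betam xv xe ->
  \sum_(v in VP | P v) (wt k v)%:R * xv v =
  \sum_(e in EP | flag k e && P (eL e)) xe e +
  \sum_(e in EP | flag k e && P (eR e)) xe e.
Proof.
move=> fx; under eq_bigr => v /andP[vVP _] do rewrite -(lp_kind fx k vVP) sum_at_v.
rewrite big_split; congr (_ + _); apply/esym.
  rewrite (partition_big (@eL beta) (fun v => (v \in VP) && P v)) /=; last first.
    by move=> e /and3P[/EPP ve _ ->]; rewrite (ep_L ve).
  apply: eq_bigr => v /andP[_ Pv]; apply: eq_bigl => e.
  by case: eqP => [->|]; rewrite ?Pv ?andbT ?andbF.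
rewrite (partition_big (@eR beta) (fun v => (v \in VP) && P v)) /=; last first.
  by move=> e /and3P[/EPP ve _ ->]; rewrite (ep_R ve).
apply: eq_bigr => v /andP[_ Pv]; apply: eq_bigl => e.
by case: eqP => [->|]; rewrite ?Pv ?andbT ?andbF.
Qed.

Lemma sum_flag_le_ends xv xe (P : pred (vprofile beta)) k :
  lp_feasible betam xv xe ->
  (forall e, e \in EP -> flag k e -> P (eL e) || P (eR e)) ->
  \sum_(e in EP | flag k e) xe e <= \sum_(v in VP | P v) (wt k v)%:R * xv v.
Proof.
move=> fx Pe; rewrite (sum_wt _ _ fx) big_mkcond [X in _ <= X + _]big_mkcond.
rewrite [X in _ <= _ + X]big_mkcond -big_split /=; apply: ler_sum => e _.
have [eEP|] := boolP (e \in EP); last by rewrite /= addr0.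
have := lp_xe_ge0 fx eEP; have := Pe e eEP.
case: (flag k e) => /= [/(_ isT)|_]; last by rewrite addr0.
by case: (P (eL e)); case: (P (eR e)) => //= _ xe0; lra.
Qed.

Lemma ends_le_sum_flag xv xe (P : pred (vprofile beta)) k :
  lp_feasible betam xv xe ->
  \sum_(v in VP | P v) (wt k v)%:R * xv v <=
  (\sum_(e in EP | flag k e) xe e) *+ 2.
Proof.
move=> fx; rewrite (sum_wt _ _ fx) mulr2n lerD // big_mkcond [leRHS]big_mkcond.
  apply: ler_sum => e _; have [eEP|] := boolP (e \in EP) => //=.
  by have := lp_xe_ge0 fx eEP; case: (flag k e) => //=; case: ifP.
apply: ler_sum => e _; have [eEP|] := boolP (e \in EP) => //=.
by have := lp_xe_ge0 fx eEP; case: (flag k e) => //=; case: ifP.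
Qed.

(** The factor 4 is 2 * 2: the [M*]-weight is at most twice the [H]-weight, by summing over profiles
    of positive degree, and the [H]-weight is at most [2 * beta] times the [M]-weight 1, by summing
    over matched profiles. *)
Lemma lp_objective_bounded xv xe :
  (0 < betam)%N -> lp_feasible betam xv xe ->
  lp_objective betam xe <= beta%:R *+ 4.
Proof.
move=> bm fx; pose sumk k := \sum_(e in EP | flag k e) xe e.
have leMs : sumk (Some false) <= sumk None *+ 2.
  apply: le_trans (ends_le_sum_flag (fun v => vdeg v != 0%N) None fx).
  apply: le_trans (sum_flag_le_ends (P := fun v => vdeg v != 0%N) fx _) _.
    move=> e /EPP ve _ /=; have [/(ep_Hdeg ve)[-> //]|/(ep_ge ve)] := boolP (eH e).
    by case: (vdeg (eL e)) => //; case: (vdeg (eR e)) => //=; case: betam bm.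
  apply: ler_sum => v /andP[vVP dv].
  rewrite ler_wpM2r ?(lp_xv_ge0 fx) // ler_nat /=.
  by rewrite (leq_trans (leq_b1 _)) // lt0n.
have leH : sumk None <= beta%:R *+ 2.
  apply: le_trans (sum_flag_le_ends fx (P := @vM beta) _) _.
    by move=> e; apply: ep_cover_vM.
  have /ler_wpM2l := ends_le_sum_flag (@vM beta) (Some true) fx.
  move=> /(_ beta%:R (ler0n _ _)).
  rewrite -/(sumk (Some true)) [sumk _](lp_norm fx).
  rewrite mulrnAr mulr1; apply: le_trans.
  rewrite mulr_sumr; apply: ler_sum => v /andP[vVP vm]; rewrite /= vm mul1r.
  by rewrite ler_wpM2r ?(lp_xv_ge0 fx) // ler_nat ltnW // ltn_ord.
rewrite (le_trans leMs) // (_ : 4 = 2 * 2)%N // mulrnA lerMn2r.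
by rewrite leH orbT.
Qed.

End Feasible.

(** * The factor-revealing program in standard form *)

Let pI : finType := (vprofile beta + eprofile beta)%type.
Let pJ : finType := option (option bool * vprofile beta).

(** The constraint [None] is the normalization. Coefficients are masked by [VP] and [EP]: a
    constraint at an invalid profile reads 0 = 0, and a variable at an invalid profile has only zero
    coefficients. *)
Definition plp_a (i : pI) (j : pJ) : int := match i, j with
  | inl v, Some (k, v') => if (v' == v) && (v \in VP) then - (wt k v)%:Z else 0
  | inr e, Some (k, v') =>
      if (v' \in VP) && [&& e \in EP, flag k e & at_v v' e] then 1 else 0
  | inl v, None => 0
  | inr e, None => if (e \in EP) && eM e then 1 else 0
  end.

Definition plp_b (j : pJ) : int := if j is Some _ then 0 else 1.

Definition plp_c (i : pI) : int := match i with
  | inl v => 0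
  | inr e => if (e \in EP) && eMs e then 1 else 0
  end.

Lemma sum_if1 (F : realFieldType) (I : finType) (P : pred I) (x : I -> F) :
  \sum_i x i * (if P i then 1 else 0)%:~R = \sum_(i | P i) x i.
Proof.
by rewrite [RHS]big_mkcond; apply: eq_bigr => i _; case: ifP; rewrite ?mulr1 ?mulr0.
Qed.

Lemma plp_obj (F : realFieldType) (x : pI -> F) :
  ilp_obj plp_c x = lp_objective betam (fun e => x (inr e)).
Proof.
rewrite /ilp_obj big_sumType /= big1 => [|v _]; last by rewrite mulr0.
by rewrite add0r (sum_if1 _ (fun e => x (inr e))).
Qed.

Lemma plp_row (F : realFieldType) (x : pI -> F) k v : v \in VP ->
  \sum_i x i * (plp_a i (Some (k, v)))%:~R =
  \sum_(e in EP | flag k e && at_v v e) x (inr e) - (wt k v)%:R * x (inl v).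
Proof.
move=> vVP; rewrite big_sumType /= vVP (sum_if1 _ (fun e => x (inr e))) addrC.
congr (_ + _); rewrite (bigD1 v) //= eqxx vVP big1 => [|v' /negPf vv'].
  by rewrite addr0 mulrC -mulNr rmorphN.
by rewrite eq_sym vv' mulr0.
Qed.

Lemma plp_feasibleP (F : realFieldType) (x : pI -> F) :
  ilp_feasible plp_a plp_b x ->
  lp_feasible betam (fun v => x (inl v)) (fun e => x (inr e)).
Proof.
case=> x0 xE; apply: lp_feasibleI => // [k v vVP|].
  by have := xE (Some (k, v)); rewrite plp_row // => /eqP; rewrite subr_eq0 => /eqP.
have := xE None; rewrite big_sumType /= big1 => [|v _]; last by rewrite mulr0.
by rewrite add0r (sum_if1 _ (fun e => x (inr e))).
Qed.

(** The default 0 outside [VP] and [EP] is there because [ilp_feasible] asks for nonnegativity at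
    every index. *)
Definition plp_pack (F : realFieldType) (xv : vprofile beta -> F)
    (xe : eprofile beta -> F) (i : pI) : F := match i with
  | inl v => if v \in VP then xv v else 0
  | inr e => if e \in EP then xe e else 0
  end.

Lemma plp_pack_feasible (F : realFieldType) (xv : vprofile beta -> F) xe :
  lp_feasible betam xv xe -> ilp_feasible plp_a plp_b (plp_pack xv xe).
Proof.
move=> fx; split=> [[v|e]|[[k v]|]] /=.
- by case: ifP => // /(lp_xv_ge0 fx).
- by case: ifP => // /(lp_xe_ge0 fx).
- have [vVP|vVP] := boolP (v \in VP).
    rewrite plp_row //= vVP -(lp_kind fx k vVP); apply/eqP; rewrite subr_eq0.
    by apply/eqP/eq_bigr => e /andP[-> _].
  rewrite big1 // => -[v'|e] _ /=; last by rewrite (negPf vVP) mulr0.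
  by case: eqP => [<-|]; rewrite ?(negPf vVP) /= mulr0.
- rewrite big_sumType /= big1 => [|v _]; last by rewrite mulr0.
  rewrite add0r (sum_if1 _ (fun e => if e \in EP then xe e else 0)).
  by rewrite -[RHS](lp_norm fx); apply: eq_bigr => e /andP[-> _].
Qed.

Lemma plp_pack_obj (F : realFieldType) (xv : vprofile beta -> F) xe :
  ilp_obj plp_c (plp_pack xv xe) = lp_objective betam xe.
Proof. by rewrite plp_obj; apply: eq_bigr => e /andP[/= -> _]. Qed.

Lemma lp_rational_optimum (F : realFieldType) (xv0 : vprofile beta -> F) xe0 :
  (0 < betam)%N -> lp_feasible betam xv0 xe0 ->
  exists (xv : vprofile beta -> rat) xe, lp_feasible betam xv xe /\
    forall (yv : vprofile beta -> F) ye, lp_feasible betam yv ye ->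
      lp_objective betam ye <= ratr (lp_objective betam xe).
Proof.
move=> bm /plp_pack_feasible fx0.
have [|x /plp_feasibleP fx xmax] := ilp_rational_optimum (c := plp_c)
    (C := beta%:R *+ 4) _ fx0.
  by move=> y /plp_feasibleP fy; rewrite plp_obj (lp_objective_bounded bm fy).
exists (fun v => x (inl v)), (fun e => x (inr e)); split=> // yv ye.
move/plp_pack_feasible => /xmax.
by rewrite plp_pack_obj plp_obj.
Qed.

Lemma lp_feasible_ratr (F : realFieldType) (xv : vprofile beta -> rat) xe :
  lp_feasible betam xv xe ->
  lp_feasible betam (fun v => ratr (xv v) : F) (fun e => ratr (xe e)).
Proof.
move=> fx; apply: lp_feasibleI => [v|e|k v vVP|].
- by rewrite ler0q; apply: (lp_xv_ge0 fx).
- by rewrite ler0q; apply: (lp_xe_ge0 fx).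
- by rewrite -rmorph_sum (lp_kind fx) // rmorphM /= ratr_nat.
- by rewrite -rmorph_sum (lp_norm fx) rmorph1.
Qed.

End ProfileLP.

(** * From graphs to feasible points *)

Section GraphProfiles.
Variables (beta betam : nat) (T : finType) (G H : sgraph T) (side : T -> bool).
Hypothesis bipG : forall u v, G u v -> side u != side v.
Hypothesis edcs : EDCS beta betam G H.
Hypothesis beta_gt1 : (1 < beta)%N.
Variables (M Ms : {set T * T}) (A B : {set T}).
Hypothesis omM : omatching (arcs H side) M.
Hypothesis omMs : omatching (arcs G side) Ms.
Hypothesis cAB : cover_pair fst snd (arcs H side) A B.
Hypothesis cardM : #|M| = (#|A| + #|B|)%N.

Let subHG : subrel H G. Proof. by case: edcs. Qed.

Let bipH u v : H u v -> side u != side v. Proof. by move/subHG/bipG. Qed.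

Let arcsHG : arcs H side \subset arcs G side.
Proof. by apply/subsetP => p; rewrite !inE => /andP[/subHG -> ->]. Qed.

Let MG : M \subset arcs G side.
Proof. by case: omM => MH _ _; apply: subset_trans MH arcsHG. Qed.

(** A neighbour in [H] has degree at least 1 and takes that much of the bound [beta]; hence degrees
    fit into ['I_beta]. *)
Lemma EDCS_deg_lt u : (deg H u < beta)%N.
Proof.
have [->|] := posnP (deg H u); first exact: ltnW.
case/card_gt0P => v; rewrite inE => Huv; case: edcs => _ /(_ _ _ Huv) le _.
have : (0 < deg H v)%N by apply/card_gt0P; exists u; rewrite inE adj_sym.
lia.
Qed.

(** The set [A] is the left part of the cover, so it corresponds to the class L \ A; the class A
    consists of the uncovered left vertices. *)
Definition gcls u :=
  if side u then if u \in A then clLA else clA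
  else if u \in B then clN else clRN.

Definition vprof u : vprofile beta :=
  (gcls u, Ordinal (EDCS_deg_lt u), matched M u, matched Ms u).

Definition family k : {set T * T} := match k with
  | None => arcs H side | Some true => M | Some false => Ms end.

Definition eprof (p : T * T) : eprofile beta :=
  (vprof p.1, vprof p.2, p \in arcs H side, p \in M, p \in Ms).

Lemma flag_eprof k p : flag k (eprof p) = (p \in family k).
Proof. by case: k => [[]|]. Qed.

Lemma adeg_family k u : adeg (family k) u = wt k (vprof u).
Proof.
case: k => [[]|] /=; rewrite ?(adeg_arcs _ bipH) // (adeg_matching _ bipG) //.
by case: omM.
Qed.

Definition used := arcs H side :|: Ms.

Let family_used k : family k \subset used.
Proof.
case: k => [[]|] /=; rewrite ?subsetUl ?subsetUr //.
by case: omM => MH _ _; apply: subset_trans MH (subsetUl _ _).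
Qed.

Let tight := let: And3 MH M1 M2 := omM in koenig_tight MH M1 M2 cAB cardM.

(** Cover vertices are matched by [koenig_tight], and [M] lies in [H], so a matched vertex has
    positive [H]-degree. *)
Lemma vprof_VP u : vprof u \in VP beta.
Proof.
rewrite inE /vcls /vdeg /vM /=; apply/andP; split; apply/implyP.
  case: tight => sA sB _; rewrite /gcls /matched.
  case: ifP => _; case: ifP => //; first by move=> /sA ->.
  by move=> /sB ->; rewrite orbT.
have : (wt (Some true) (vprof u) <= wt None (vprof u))%N.
  rewrite -!adeg_family; case: omM => /subsetP MH _ _.
  by apply: leq_add; apply/subset_leq_card/subsetP => p;
    rewrite !inE => /andP[/MH]; rewrite inE => -> ->.
by rewrite /= /vdeg /vM /= => le /eqP d0; rewrite d0 leqn0 eqb0 in le.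
Qed.

Lemma eprof_EP p : p \in used -> eprof p \in EP beta betam.
Proof.
move=> pU; have [Gp sp1 sp2] : [/\ G p.1 p.2, side p.1 & ~~ side p.2].
  apply: arcs_side bipG _.
  suff /subsetP : used \subset arcs G side by apply.
  by rewrite /used subUset arcsHG /=; case: omMs.
(* The conditions on the ends of [H]-, [M]- and [M*]-edges at once: an arc of a family gives both
   its ends positive degree in it. *)
have fam k : p \in family k ->
    (0 < wt k (vprof p.1))%N /\ (0 < wt k (vprof p.2))%N.
  by move/adeg_gt0; rewrite !adeg_family.
have [_ _ cM] := tight; have [_ leH geG] := edcs.
apply/EPP; split; rewrite /eL /eR /eH /eM /eMs /= ?vprof_VP //.
- by rewrite /vcls /= /gcls sp1; case: ifP.
- by rewrite /vcls /= /gcls (negPf sp2); case: ifP.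
- by move/(fam None); rewrite -!lt0n.
- by move/(fam (Some true)) => /=; rewrite !lt0b.
- by move/(fam (Some false)) => /=; rewrite !lt0b.
- by case: omM => /subsetP MH _ _; apply: MH.
- by move: pU; rewrite inE.
- by rewrite inE => /andP[/leH].
- by rewrite inE sp1 andbT; apply: geG.
- rewrite /vcls /= /gcls sp1 (negPf sp2).
  by move/forall_inP: cAB => h /h; case: (p.1 \in A); case: (p.2 \in B).
- move/cM; rewrite /vcls /= /gcls sp1 (negPf sp2).
  by case: (p.1 \in A); case: (p.2 \in B).
Qed.

Section Counts.
Variable R : realFieldType.
Let K : R := #|M|%:R.
Hypothesis M_gt0 : (0 < #|M|)%N.

Definition cnt_v (v : vprofile beta) : R := #|[set u | vprof u == v]|%:R / K.
Definition cnt_e (e : eprofile beta) : R :=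
  #|[set p in used | eprof p == e]|%:R / K.

Lemma sum_cnt_e (Q : pred (eprofile beta)) :
  \sum_(e in EP beta betam | Q e) cnt_e e =
  #|[set p in used | Q (eprof p)]|%:R / K.
Proof.
rewrite -mulr_suml -natr_sum; congr (_%:R / _); apply/esym.
rewrite -sum1dep_card.
rewrite (partition_big eprof (fun e => (e \in EP beta betam) && Q e)) /=; last first.
  by move=> p /andP[/eprof_EP -> ->].
apply: eq_bigr => e /andP[_ Qe]; rewrite -sum1dep_card; apply: eq_bigl => p.
by case: eqP => [->|]; rewrite ?Qe ?andbT ?andbF.
Qed.

Lemma card_family k (Q : pred (T * T)) :
  #|[set p in used | flag k (eprof p) && Q p]| = #|[set p in family k | Q p]|.
Proof.
apply: eq_card => p; rewrite [in LHS]inE [in RHS]inE flag_eprof.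
by case pf: (p \in family k); rewrite ?andbF //= (subsetP (family_used k)).
Qed.

Lemma sum_fibers (F : {set T * T}) (f : T * T -> T) (P : pred T) :
  #|[set p in F | P (f p)]| = (\sum_(u | P u) #|[set p in F | f p == u]|)%N.
Proof.
rewrite -sum1dep_card (partition_big f P) => [|p /andP[_ //]].
apply: eq_bigr => u Pu; rewrite -sum1dep_card; apply: eq_bigl => p.
by case: eqP => [->|]; rewrite ?Pu ?andbT ?andbF.
Qed.

Lemma graph_lp_feasible : lp_feasible betam cnt_v cnt_e.
Proof.
have ge0 n : 0 <= n%:R / K by rewrite divr_ge0 ?ler0n.
apply: lp_feasibleI => [v _|e _|k v _|]; rewrite ?ge0 //.
  rewrite sum_at_v !sum_cnt_e /eL /eR /= -mulrDl -natrD.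
  rewrite (card_family k (fun p => vprof p.1 == v)).
  rewrite (card_family k (fun p => vprof p.2 == v)).
  (* Grouping arcs by their end of profile [v] makes the two counts add up to [adeg] at each such
     vertex. *)
  rewrite (sum_fibers _ fst (fun u => vprof u == v)).
  rewrite (sum_fibers _ snd (fun u => vprof u == v)) -big_split /=.
  rewrite (eq_bigr (fun _ => wt k v)) => [|u /eqP <-]; last exact: adeg_family.
  by rewrite sum_nat_cond_const natrM [_ * (wt _ _)%:R]mulrC mulrA.
rewrite sum_cnt_e (_ : #|_| = #|M|) ?divff ?pnatr_eq0 -?lt0n //.
apply: eq_card => p; rewrite inE; apply: andb_idl => pM.
exact: (subsetP (family_used (Some true))).
Qed.

Lemma graph_lp_objective : lp_objective betam cnt_e = #|Ms|%:R / K.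
Proof.
rewrite /lp_objective sum_cnt_e; congr (_%:R / _).
apply: eq_card => p; rewrite inE; apply: andb_idl => pM.
exact: (subsetP (family_used (Some false))).
Qed.

End Counts.
End GraphProfiles.

Lemma EDCS_lp_feasible (R : realFieldType) (beta betam : nat) (T : finType)
    (G H : sgraph T) :
  (1 < beta)%N -> bipartite G -> EDCS beta betam G H -> (0 < mu H)%N ->
  exists (xv : vprofile beta -> R) xe, lp_feasible betam xv xe /\
    lp_objective betam xe * (mu H)%:R = (mu G)%:R.
Proof.
move=> beta_gt1 [side bipG] edcs muH.
have bipH u v : H u v -> side u != side v by case: edcs => HG _ _ /HG /bipG.
have [M [A [B [MH M1 M2 cAB cM]]]] := koenig fst snd (arcs H side).
have omM : omatching (arcs H side) M by [].
have muHE : mu H = #|M|.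
  apply/eqP; rewrite eqn_leq (omatching_le_mu bipH omM) andbT cM.
  exact: mu_le_cover bipH cAB.
have [Ms omMs leMs] := mu_omatching bipG.
have muGE : mu G = #|Ms|.
  by apply/eqP; rewrite eqn_leq (omatching_le_mu bipG omMs) andbT.
rewrite muHE in muH *; rewrite muGE.
do 2!eexists; split.
  exact: (graph_lp_feasible bipG edcs beta_gt1 omM omMs cAB cM R muH).
rewrite (graph_lp_objective bipG edcs beta_gt1 omM omMs cAB cM) divfK //.
by rewrite pnatr_eq0 -lt0n.
Qed.

(** The case in which counts cannot be divided by [mu H]. Here [H] has no edge, all its degrees
    vanish, and an edge of [G] would violate the lower bound [betam > 0]; so the empty cover
    suffices. *)
Lemma EDCS_mu_eq0 (beta betam : nat) (T : finType) (G H : sgraph T) :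
  (0 < betam)%N -> bipartite G -> EDCS beta betam G H -> mu H = 0%N -> mu G = 0%N.
Proof.
move=> bm [side bipG] [HG _ geG] muH.
have bipH u v : H u v -> side u != side v by move/HG/bipG.
have noH u v : H u v = false.
  apply/negP; wlog su : u v / side u => [wl Huv|Huv].
    have [su|su] := boolP (side u); first exact: wl su Huv.
    apply: (wl v u); last by rewrite adj_sym.
    by have := bipH _ _ Huv; rewrite (negPf su); case: (side v).
  have : (#|[set (u, v)]| <= mu H)%N.
    apply: (omatching_le_mu (side := side) bipH); split.
    - by rewrite sub1set inE /= Huv.
    - by move=> x y; rewrite !inE => /eqP -> /eqP ->.
    - by move=> x y; rewrite !inE => /eqP -> /eqP ->.
  by rewrite cards1 muH.
have deg0 u : deg H u = 0%N.
  by apply/eqP; rewrite cards_eq0; apply/eqP/setP => v; rewrite !inE noH.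
apply/eqP; rewrite -leqn0.
have -> : 0%N = (#|@set0 T| + #|@set0 T|)%N by rewrite cards0.
apply: (mu_le_cover (side := side) bipG); apply/forall_inP => p.
rewrite inE => /andP[Gp _]; have := geG _ _ Gp; rewrite noH !deg0 => /(_ isT).
by move=> le; move: bm; rewrite ltnNge le.
Qed.

(** * From feasible points to graphs *)

(** A window of [n] consecutive integers meets each residue once: sliding it by one trades [b] for
    [b + n], of the same residue. *)
Lemma count_mod_iota n c d i : (i < n)%N ->
  count (fun j => j %% n == i)%N (iota c (d * n)) = d.
Proof.
move=> lt_in; have n_gt0 : (0 < n)%N by apply: leq_trans lt_in.
have one b : count (fun j => j %% n == i)%N (iota b n) = 1%N.
  elim: b => [|b IHb].
    rewrite (@eq_in_count _ _ (pred1 i)) => [|j]; last first.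
      by rewrite mem_iota => /andP[_ lt]; rewrite modn_small.
    by rewrite count_uniq_mem ?iota_uniq // mem_iota lt_in.
  have := count_cat (fun j => j %% n == i)%N (iota b n) [:: (b + n)%N].
  rewrite -(iotaD b n 1) addn1 /= IHb modnDr addn0; lia.
elim: d c => [|d IHd] c; first by rewrite mul0n.
by rewrite mulSn iotaD count_cat one IHd.
Qed.

Lemma map_index_infix (X : eqType) (p s q : seq X) : uniq (p ++ s ++ q) ->
  [seq index x (p ++ s ++ q) | x <- s] = iota (size p) (size s).
Proof.
case: s => [//|x0 s]; set t := p ++ _ => ut.
apply: (@eq_from_nth _ 0%N) => [|i]; rewrite size_map ?size_iota // => lt_i.
rewrite nth_iota // (nth_map x0) //.
have -> : nth x0 (x0 :: s) i = nth x0 t (size p + i).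
  by rewrite nth_cat ltnNge leq_addr addKn nth_cat lt_i.
by rewrite index_uniq // !size_cat; lia.
Qed.

(* Rank the items in the order m \ ms, m & ms, (h & ms) \ m, followed by either
   h \ (m | ms) or ms \ h: each of h, m, ms then occupies an interval of ranks whose
   length is a multiple of n, so reducing ranks modulo n balances all three. *)
Lemma balanced_assignment (X : finType) (h m ms : {set X}) (n a b d : nat) :
  m \subset h -> #|h| = (d * n)%N -> #|m| = (a * n)%N -> #|ms| = (b * n)%N ->
  exists f : X -> nat, ((0 < n)%N -> forall x, (f x < n)%N) /\
    forall i, (i < n)%N ->
    [/\ #|[set x in h | f x == i]| = d, #|[set x in m | f x == i]| = a
      & #|[set x in ms | f x == i]| = b].
Proof.
move=> /subsetP mh ch cm cms.
pose s1 := enum (m :\: ms); pose s2 := enum (m :&: ms).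
pose s3 := enum ((h :&: ms) :\: m); pose s4 := enum (h :\: (m :|: ms)).
pose s5 := enum (ms :\: h).
pose sh := s1 ++ s2 ++ s3 ++ s4; pose s' := s1 ++ s2 ++ s3 ++ s5.
have ush : uniq sh.
  rewrite /sh !cat_uniq !enum_uniq /= andbT; repeat (apply/andP; split) => //;
  by apply/hasPn => x; rewrite /= !(mem_cat, mem_enum, inE); have := mh x;
    case: (x \in h); case: (x \in m); case: (x \in ms) => //= /(_ isT).
have us' : uniq s'.
  rewrite /s' !cat_uniq !enum_uniq /= andbT; repeat (apply/andP; split) => //;
  by apply/hasPn => x; rewrite /= !(mem_cat, mem_enum, inE); have := mh x;
    case: (x \in h); case: (x \in m); case: (x \in ms) => //= /(_ isT).
pose g x := if x \in h then index x sh else index x s'.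
have key (F : {set X}) (s : seq X) (c e i : nat) : uniq s -> s =i F ->
    map g s = iota c (size s) -> #|F| = (e * n)%N -> (i < n)%N ->
    #|[set x in F | (g x %% n == i)%N]| = e.
  move=> us sF gs cF lt_in.
  have sz : size s = (e * n)%N by rewrite -cF -(card_uniqP us); apply: eq_card.
  rewrite -(count_mod_iota c e lt_in) -sz -gs count_map -size_filter.
  rewrite -(card_uniqP (filter_uniq _ us)); apply: eq_card => x.
  by rewrite inE mem_filter sF andbC.
exists (fun x => g x %% n)%N; split=> [n_gt0 x|i lt_in]; first by rewrite ltn_mod.
split.
- apply: (@key h sh 0%N) => // [x|].
    rewrite !(mem_cat, mem_enum, inE); have := mh x.
    by case: (x \in h); case: (x \in m); case: (x \in ms) => //= /(_ isT).
  have := @map_index_infix _ [::] sh [::]; rewrite /= cats0 => <- //.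
  apply/eq_in_map => x; rewrite /g; case: ifP => // xh.
  rewrite !(mem_cat, mem_enum, inE); have := mh x; rewrite xh.
  by case: (x \in m); case: (x \in ms) => //= /(_ isT).
- apply: (@key m (s1 ++ s2) 0%N) => // [|x|].
  + by move: ush; rewrite /sh catA cat_uniq => /andP[].
  + by rewrite !(mem_cat, mem_enum, inE); case: (x \in m); case: (x \in ms).
  have := @map_index_infix _ [::] (s1 ++ s2) (s3 ++ s4).
  rewrite /= -catA => <- //; apply/eq_in_map => x xs; rewrite /g mh //.
  by move: xs; rewrite !(mem_cat, mem_enum, inE); case: (x \in m); case: (x \in ms).
- apply: (@key ms (s2 ++ s3 ++ s5) (size s1)) => // [|x|].
  + by move: us'; rewrite /s' cat_uniq => /and3P[].
  + rewrite !(mem_cat, mem_enum, inE); have := mh x.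
    by case: (x \in h); case: (x \in m); case: (x \in ms) => //= /(_ isT).
  have := @map_index_infix _ s1 (s2 ++ s3 ++ s5) [::].
  rewrite cats0 => <- //; apply/eq_in_map => x xs; rewrite /g; case: ifP => // xh.
  have x23 : x \in s1 ++ s2 ++ s3.
    move: xs; rewrite !(mem_cat, mem_enum, inE) xh.
    by case: (x \in m); case: (x \in ms).
  have sE u : s1 ++ s2 ++ s3 ++ u = (s1 ++ s2 ++ s3) ++ u by rewrite !catA.
  by rewrite /sh !sE !index_cat x23.
Qed.

Lemma common_denominator (I : finType) (q : I -> rat) :
  exists2 D : nat, (0 < D)%N & forall i, q i * D%:R \is a Num.int.
Proof.
exists (\prod_i `|denq (q i)|)%N; first by rewrite prodn_gt0 // => i; rewrite absz_gt0.
move=> i; rewrite (bigD1 i) //= natrM mulrA rpredM ?natr_int //.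
have -> : `|denq (q i)|%:R = (denq (q i))%:~R :> rat by rewrite -[in RHS]absz_denq.
by rewrite -numqE intr_int.
Qed.

Section ArcGraphs.
Variable T : finType.
Implicit Types (D : {set T * T}) (side : T -> bool).

Definition arc_rel D : rel T :=
  [rel u v | (u != v) && (((u, v) \in D) || ((v, u) \in D))].

Lemma arc_rel_sym D : symmetric (arc_rel D).
Proof. by move=> u v; rewrite /arc_rel /= eq_sym orbC. Qed.

Lemma arc_rel_irr D : irreflexive (arc_rel D).
Proof. by move=> u; rewrite /arc_rel /= eqxx. Qed.

Definition arc_graph D := SGraph (@arc_rel_sym D) (@arc_rel_irr D).

Definition oriented side D :=
  forall p, p \in D -> side p.1 /\ ~~ side p.2.

Lemma arc_graph_bip side D : oriented side D ->
  forall u v, arc_graph D u v -> side u != side v.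
Proof.
by move=> oD u v /= /andP[_ /orP[]] /oD /= [su sv]; rewrite su (negPf sv).
Qed.

Lemma arcs_arc_graph side D : oriented side D -> arcs (arc_graph D) side = D.
Proof.
move=> oD; apply/setP => -[u v]; rewrite inE /=; apply/idP/idP.
  by case/andP => /andP[_ /orP[//|/oD[/= _ /negPf ->]]].
move=> uvD; have [/= su sv] := oD _ uvD; rewrite /arc_rel /= uvD su /= !andbT.
by apply: contraNneq sv => <-.
Qed.

End ArcGraphs.

Lemma card_split_in (F : finType) (S : {set F}) (a b c : pred F) :
  {in S, forall x, (c x : nat) = (a x + b x)%N} ->
  (#|[set x in S | a x]| + #|[set x in S | b x]|)%N = #|[set x in S | c x]|.
Proof.
move=> cab; rewrite -cardsUI [X in (_ + X)%N](_ : _ = 0%N) ?addn0.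
  apply: eq_card => x; rewrite !inE; have [/cab|//] := boolP (x \in S).
  by case: (a x); case: (b x); case: (c x).
apply/eqP; rewrite cards_eq0; apply/eqP/setP => x; rewrite !inE.
have [/cab|//] := boolP (x \in S).
by case: (a x); case: (b x); case: (c x).
Qed.

(** * The base multigraph of an integral solution *)

Section TightGraph.
Variables (beta betam : nat).
Variables (X : vprofile beta -> nat) (Y : eprofile beta -> nat).
Notation VP := (VP beta).
Notation EP := (EP beta betam).
Hypothesis XY : forall k v, v \in VP ->
  (\sum_(e in EP | flag k e && at_v v e) Y e = wt k v * X v)%N.

(** A common bound on all multiplicities: numbered copies of vertex profiles and of edge profiles
    then share the index type ['I_N.+1]. *)
Let N : nat := (\max_v X v + \max_e Y e)%N.
Notation item := (eprofile beta * 'I_N.+1)%type.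

Definition items : {set item} := [set x : item | (x.1 \in EP) && (x.2 < Y x.1)%N].
Definition fitems k : {set item} := [set x in items | flag k x.1].

Lemma in_items x : (x \in items) = (x.1 \in EP) && (x.2 < Y x.1)%N.
Proof. by rewrite [LHS]in_set. Qed.

Lemma in_fitems k x : (x \in fitems k) = (x \in items) && flag k x.1.
Proof. by rewrite [LHS]in_set. Qed.

Let X_le v : (X v <= N)%N.
Proof. exact: leq_trans (leq_bigmax v) (leq_addr _ _). Qed.

Let Y_le e : (Y e <= N)%N.
Proof. exact: leq_trans (leq_bigmax e) (leq_addl _ _). Qed.

Lemma card_items (Q : pred (eprofile beta)) :
  #|[set x in items | Q x.1]| = (\sum_(e in EP | Q e) Y e)%N.
Proof.
rewrite -sum1dep_card.
rewrite (partition_big fst (fun e => (e \in EP) && Q e)) => [|x]; last first.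
  by rewrite in_items => /andP[/andP[-> _] ->].
apply: eq_bigr => e /andP[eEP Qe].
rewrite -[RHS]card_ord sum1dep_card.
rewrite -(card_imset (f := fun j : 'I_(Y e) => (e, widen_ord (leqW (Y_le e)) j))).
  apply: eq_card => -[e' j]; rewrite in_set in_items /=.
  apply/idP/imsetP => [|[i _ [-> ->]]].
    case/andP => /andP[/andP[_ lt] _] /eqP ee; subst e'.
    by exists (Ordinal lt) => //; congr pair; apply: val_inj.
  by rewrite eEP Qe eqxx /= ltn_ord.
by move=> i j [ij]; apply: val_inj.
Qed.

(** [pos v x] is the copy of [v] to which [x] is attached. By [XY] the three families of items at
    [v] have sizes [wt k v * X v], so [balanced_assignment] spreads them evenly over the [X v]
    copies. *)
Lemma items_assignment : exists pos : vprofile beta -> item -> nat,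
  forall v, v \in VP -> ((0 < X v)%N -> forall x, (pos v x < X v)%N) /\
  forall k i, (i < X v)%N ->
  #|[set x in fitems k | at_v v x.1 && (pos v x == i)]| = wt k v.
Proof.
apply: (@fin_all_exists (vprofile beta) (fun=> item -> nat)
  (fun v f => v \in VP -> ((0 < X v)%N -> forall x, (f x < X v)%N) /\
  forall k i, (i < X v)%N ->
  #|[set x in fitems k | at_v v x.1 && (f x == i)]| = wt k v)) => v.
have [vVP|] := boolP (v \in VP); last by exists (fun=> 0%N).
pose F k := [set x in items | flag k x.1 && at_v v x.1].
have cF k : #|F k| = (wt k v * X v)%N by rewrite -XY // -card_items.
have [|f [f_lt fE]] :=
    balanced_assignment _ (cF None) (cF (Some true)) (cF (Some false)).
  apply/subsetP => x; rewrite [_ \in F _]in_set => /and3P[xI Mx vx].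
  rewrite in_set xI vx andbT; move: xI; rewrite in_items => /andP[/EPP ve _].
  exact: ep_MH ve Mx.
exists f => _; split=> // k i lt_i.
rewrite (_ : [set x in _ | _] = [set x in F k | f x == i]).
  by have [] := fE i lt_i; case: k => [[]|].
apply/setP => x; rewrite [LHS]in_set [RHS]in_set in_fitems [_ \in F _]in_set.
by rewrite !andbA.
Qed.


(** * The cyclic voltage lift *)

Section Lift.
Variable pos : vprofile beta -> item -> nat.
Hypothesis pos_lt : forall v, v \in VP -> (0 < X v)%N ->
  forall x, (pos v x < X v)%N.
Hypothesis card_pos : forall v, v \in VP -> forall k i, (i < X v)%N ->
  #|[set x in fitems k | at_v v x.1 && (pos v x == i)]| = wt k v.

Definition base_L (x : item) : vprofile beta * 'I_N.+1 :=
  (eL x.1, inord (pos (eL x.1) x)).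
Definition base_R (x : item) : vprofile beta * 'I_N.+1 :=
  (eR x.1, inord (pos (eR x.1) x)).

(** The group order [item_count.+1] exceeds every [enum_rank], and its successor form provides the
    group structure on ordinals. *)
Definition item_count := #|{: item}|.
Notation Z := 'I_item_count.+1.
Notation vertex := ((vprofile beta * 'I_N.+1) * Z)%type.

(* Distinct items carry distinct voltages, so the lift of the base multigraph to
   the cyclic group Z has no parallel edges. *)
Definition voltage (x : item) : Z := inord (enum_rank x).

Definition lift_arc (y : item * Z) : vertex * vertex :=
  ((base_L y.1, y.2), (base_R y.1, y.2 + voltage y.1)).

Definition larcs k : {set vertex * vertex} :=
  lift_arc @: setX (fitems k) [set: Z].

Definition vside (u : vertex) := Defs.is_left (vcls u.1.1).

Lemma voltage_inj : injective voltage.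
Proof.
move=> x y /(congr1 val); rewrite /= !inordK ?ltnS 1?ltnW ?ltn_ord //.
by move/val_inj/enum_rank_inj.
Qed.

Lemma lift_arc_inj : injective lift_arc.
Proof.
move=> [x z] [y t] eq_xy; have zt : z = t := congr1 (fun p => p.1.2) eq_xy.
have := congr1 (fun p => p.2.2) eq_xy; rewrite /= zt => /addrI/voltage_inj.
by move=> ->.
Qed.

Lemma larcsP k p : reflect (exists x z, [/\ x \in items, flag k x.1
  & p = lift_arc (x, z)]) (p \in larcs k).
Proof.
apply: (iffP imsetP) => [[[x z]]|[x [z [xI fx ->]]]].
  by rewrite in_setX in_fitems => /andP[/andP[xI fx] _] ->; exists x, z.
by exists (x, z); rewrite // in_setX in_fitems xI fx in_setT.
Qed.

Lemma card_larcs k :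
  #|larcs k| = ((\sum_(e in EP | flag k e) Y e) * item_count.+1)%N.
Proof.
rewrite (card_imset _ lift_arc_inj) cardsX cardsT card_ord -card_items.
by congr (_ * _)%N; apply: eq_card => x; rewrite in_fitems [RHS]in_set.
Qed.

(** An item lies in [H] or [M*], so the constraint of that kind at either end has a positive left
    side; this forces [X] to be positive there, and [pos] then stays in range. *)
Lemma items_valid x : x \in items -> [/\ ep_valid betam x.1,
  (pos (eL x.1) x < X (eL x.1))%N & (pos (eR x.1) x < X (eR x.1))%N].
Proof.
rewrite in_items => /andP[eEP lt_Y]; have ve := EPP _ _ eEP.
have X_gt0 v : v \in VP -> at_v v x.1 -> (0 < X v)%N.
  move=> vVP av; have [k fk] : exists k, flag k x.1.
    by case/orP: (ep_HMs ve) => ?; [exists None|exists (Some false)].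
  have := XY k vVP; rewrite (bigD1 x.1) /= ?eEP ?fk // => XYv.
  case: (X v) XYv => // /eqP; rewrite muln0 addn_eq0 => /andP[/eqP Y0 _].
  by rewrite Y0 in lt_Y.
by split=> //; apply: pos_lt; rewrite ?X_gt0 /at_v ?eqxx ?orbT //;
  [apply: ep_L ve|apply: ep_L ve|apply: ep_R ve|apply: ep_R ve].
Qed.

Lemma larcs_oriented k : oriented vside (larcs k).
Proof.
move=> p /larcsP[x [z [/items_valid[ve _ _] _ ->]]]; rewrite /vside /=.
by split; rewrite ?(ep_left ve) //; have := ep_right ve; case: (vcls (eR x.1)).
Qed.

Lemma base_LE x v (i : 'I_N.+1) : x \in items ->
  (base_L x == (v, i)) = (eL x.1 == v) && (pos v x == i).
Proof.
case/items_valid => _ lt _; rewrite xpair_eqE; case: eqP => //= <-.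
by rewrite -val_eqE /= inordK // ltnS (leq_trans (ltnW lt)).
Qed.

Lemma base_RE x v (i : 'I_N.+1) : x \in items ->
  (base_R x == (v, i)) = (eR x.1 == v) && (pos v x == i).
Proof.
case/items_valid => _ _ lt; rewrite xpair_eqE; case: eqP => //= <-.
by rewrite -val_eqE /= inordK // ltnS (leq_trans (ltnW lt)).
Qed.

(** A base edge has exactly one lift through each point of the fibre over either of its ends, so the
    lift keeps degrees. *)
Lemma card_larcs_fst k w z :
  #|[set p in larcs k | p.1 == (w, z)]| = #|[set x in fitems k | base_L x == w]|.
Proof.
rewrite -[RHS](card_imset (f := fun x => lift_arc (x, z))); last first.
  by move=> x y /lift_arc_inj[].
apply: eq_card => p; rewrite in_set; apply/andP/imsetP.
  case=> /larcsP[x [t [xI fx ->]]] /eqP[bx tz]; exists x; last by rewrite tz.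
  by rewrite in_set in_fitems xI fx bx /=.
case=> x; rewrite in_set in_fitems => /andP[/andP[xI fx] /eqP bx] ->.
by split; [apply/larcsP; exists x, z|rewrite /= bx].
Qed.

Lemma card_larcs_snd k w z :
  #|[set p in larcs k | p.2 == (w, z)]| = #|[set x in fitems k | base_R x == w]|.
Proof.
(* The arc over [x] that ends in layer [z] starts in layer [z - voltage x]. *)
rewrite -[RHS](card_imset (f := fun x => lift_arc (x, z - voltage x))); last first.
  by move=> x y /lift_arc_inj[].
apply: eq_card => p; rewrite in_set; apply/andP/imsetP.
  case=> /larcsP[x [t [xI fx ->]]] /eqP[bx tz]; exists x.
    by rewrite in_set in_fitems xI fx bx /=.
  by rewrite -tz addrK.
case=> x; rewrite in_set in_fitems => /andP[/andP[xI fx] /eqP bx] ->.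
by split; [apply/larcsP; exists x, (z - voltage x)|rewrite /= bx subrK].
Qed.

Lemma adeg_larcs k v (i : 'I_N.+1) z : v \in VP -> (i < X v)%N ->
  adeg (larcs k) ((v, i), z) = wt k v.
Proof.
move=> vVP lt_i; rewrite -[RHS](card_pos vVP k lt_i) /adeg.
apply: etrans (congr2 addn (card_larcs_fst k _ z) (card_larcs_snd k _ z)) _.
apply: card_split_in => x; rewrite in_fitems => /andP[xI _].
rewrite base_LE // base_RE //; move: xI; rewrite in_items => /andP[/(at_vE v)].
by case: (at_v v x.1); case: (_ == v); case: (_ == v); case: (_ == _).
Qed.

Lemma adeg_lift_arc k x z : x \in items ->
  adeg (larcs k) (lift_arc (x, z)).1 = wt k (eL x.1) /\
  adeg (larcs k) (lift_arc (x, z)).2 = wt k (eR x.1).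
Proof.
move=> xI; have [ve ltL ltR] := items_valid xI.
have leN v i : (i < X v)%N -> (i < N.+1)%N.
  by move=> lt; apply: leq_trans lt (leqW (X_le v)).
by split; apply: adeg_larcs; rewrite ?(ep_L ve) ?(ep_R ve) // inordK //;
  apply: leN; [exact: ltL|exact: ltR].
Qed.

Let Hg := arc_graph (larcs None).
Let Gg := arc_graph (larcs None :|: larcs (Some false)).

Let orG : oriented vside (larcs None :|: larcs (Some false)).
Proof. by move=> p; rewrite in_setU => /orP[]; apply: larcs_oriented. Qed.

Lemma deg_lift u : deg Hg u = adeg (larcs None) u.
Proof.
have or := larcs_oriented (k := None).
by rewrite -(adeg_arcs u (arc_graph_bip or)) arcs_arc_graph.
Qed.

(** Each end of a lifted arc has the degree recorded in its profile, so both degree conditions are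
    read off [ep_le] and [ep_ge]. *)
Lemma lift_EDCS : EDCS beta betam Gg Hg.
Proof.
split=> [u v|u v|u v] /=; rewrite /arc_rel /=.
- by case/andP => -> /orP[] h; rewrite !in_setU h ?orbT.
- case/andP => _ uv; rewrite !deg_lift.
  suff wl a b : (a, b) \in larcs None ->
      (adeg (larcs None) a + adeg (larcs None) b <= beta)%N.
    case/orP: uv => /wl le_ab; first exact: le_ab.
    rewrite addnC; exact: le_ab.
  case/larcsP => x [z [xI fx [-> ->]]]; have [ve _ _] := items_valid xI.
  have [-> ->] := adeg_lift_arc None z xI; exact: ep_le ve fx.
case/andP => nuv; rewrite nuv /= !in_setU => uv nH; rewrite !deg_lift.
move: uv nH; case Huv: ((u, v) \in larcs None) => //=.
case Hvu: ((v, u) \in larcs None); rewrite ?orbT //= => uv _.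
suff wl a b : (a, b) \in larcs (Some false) -> (a, b) \notin larcs None ->
    (betam <= adeg (larcs None) a + adeg (larcs None) b)%N.
  case/orP: uv => /wl; rewrite ?Huv ?Hvu => /(_ isT) ge_ab; first exact: ge_ab.
  rewrite addnC; exact: ge_ab.
case/larcsP => x [z [xI fx abE]] nH; have [ve _ _] := items_valid xI.
have [] := adeg_lift_arc None z xI; rewrite -abE /= => -> ->.
apply: (ep_ge ve); apply: contra nH => Hx.
by apply/larcsP; exists x, z.
Qed.

(** For [M] and [M*] the prescribed degrees are at most 1. *)
Lemma larcs_matching k (D : {set vertex * vertex}) :
  k != None -> larcs k \subset D -> omatching D (larcs k).
Proof.
move=> kN kD; have wt_le1 v : (wt k v <= 1)%N.
  by case: k kN {kD} => [[]|] //= _; apply: leq_b1.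
have le1 (x : item) z : x \in items ->
    (adeg (larcs k) (lift_arc (x, z)).1 <= 1)%N /\
    (adeg (larcs k) (lift_arc (x, z)).2 <= 1)%N.
  by move=> xI; have [-> ->] := adeg_lift_arc k z xI.
split=> // p q pM qM pq.
  case/larcsP: (pM) => x [z [xI _ pE]]; have [] := le1 x z xI; rewrite -pE => le _.
  have /card_le1_eqP/(_ q p) : (#|[set r in larcs k | r.1 == p.1]| <= 1)%N.
    exact: leq_trans (leq_addr _ _) le.
  by apply; rewrite in_set ?pM ?qM ?pq eqxx.
case/larcsP: (pM) => x [z [xI _ pE]]; have [] := le1 x z xI; rewrite -pE => _ le.
have /card_le1_eqP/(_ q p) : (#|[set r in larcs k | r.2 == p.2]| <= 1)%N.
  exact: leq_trans (leq_addl _ _) le.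
by apply; rewrite in_set ?pM ?qM ?pq eqxx.
Qed.

Lemma larcs_MH : larcs (Some true) \subset larcs None.
Proof.
apply/subsetP => p /larcsP[x [z [xI fx ->]]]; apply/larcsP; exists x, z.
by split=> //; have [ve _ _] := items_valid xI; apply: ep_MH ve fx.
Qed.

(** The bound by [X] leaves out the padding vertices of ['I_N.+1], which meet no arc. *)
Definition cls_set s : {set vertex} :=
  [set u : vertex | [&& u.1.1 \in VP, vcls u.1.1 == s & (u.1.2 < X u.1.1)%N]].

Lemma in_cls_set s u : (u \in cls_set s) =
  [&& u.1.1 \in VP, vcls u.1.1 == s & (u.1.2 < X u.1.1)%N].
Proof. by rewrite [LHS]in_set. Qed.

Lemma lift_arc_cls x z s : x \in items ->
  ((lift_arc (x, z)).1 \in cls_set s) = (vcls (eL x.1) == s) /\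
  ((lift_arc (x, z)).2 \in cls_set s) = (vcls (eR x.1) == s).
Proof.
move=> xI; have [ve ltL ltR] := items_valid xI.
have leN v i : (i < X v)%N -> (i < N.+1)%N.
  by move=> lt; apply: leq_trans lt (leqW (X_le v)).
by rewrite !in_cls_set /= !inordK ?(leN _ _ ltL) ?(leN _ _ ltR) // ltL ltR
  (ep_L ve) (ep_R ve) !andbT.
Qed.

Lemma lift_cover : cover_pair fst snd (larcs None) (cls_set clLA) (cls_set clN).
Proof.
apply/forall_inP => p /larcsP[x [z [xI fx ->]]].
have [-> _] := lift_arc_cls z clLA xI; have [_ ->] := lift_arc_cls z clN xI.
have [ve _ _] := items_valid xI; have := ep_cover ve fx.
have := ep_left ve; have := ep_right ve.
by case: (vcls (eL x.1)) => //; case: (vcls (eR x.1)).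
Qed.

(** Validity gives every vertex of these classes [M]-degree 1, and by [ep_exact] no [M]-arc joins L
    \ A to N, so distinct cover vertices use distinct [M]-arcs. *)
Lemma card_lift_cover :
  (#|cls_set clLA| + #|cls_set clN| <= #|larcs (Some true)|)%N.
Proof.
set M := larcs _.
have [_ M1 M2] : omatching M M by apply: larcs_matching.
have adegM s u : s \in [:: clLA; clN] -> u \in cls_set s -> adeg M u = 1%N.
  move=> sin; rewrite in_cls_set; case: u => [[v i] z] /= /and3P[vVP /eqP vs lt_i].
  rewrite adeg_larcs //=; move: vVP; rewrite in_set vs => /andP[/implyP->] //.
  by move: sin; rewrite !inE => /orP[]/eqP->.
have bipH := arc_graph_bip (larcs_oriented (k := None)).
have MH : M \subset arcs Hg vside.
  by rewrite arcs_arc_graph ?larcs_MH //; apply: larcs_oriented.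
have leA : (#|cls_set clLA| <= #|[set p in M | p.1 \in cls_set clLA]|)%N.
  apply: leq_trans (leq_imset_card fst _); apply/subset_leq_card/subsetP => u uA.
  have := adegM clLA u isT uA; rewrite (adegE u bipH MH).
  have -> : vside u by move: uA; rewrite in_cls_set /vside => /and3P[_ /eqP -> _].
  move=> c1; have /card_gt0P[p] : (0 < #|[set p in M | p.1 == u]|)%N by rewrite c1.
  rewrite in_set => /andP[pM /eqP pu]; apply/imsetP; exists p => //.
  by rewrite in_set pM pu.
have leB : (#|cls_set clN| <= #|[set p in M | p.2 \in cls_set clN]|)%N.
  apply: leq_trans (leq_imset_card snd _); apply/subset_leq_card/subsetP => u uA.
  have := adegM clN u isT uA; rewrite (adegE u bipH MH).
  have /negPf -> : ~~ vside u.
    by move: uA; rewrite in_cls_set /vside => /and3P[_ /eqP -> _].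
  move=> c1; have /card_gt0P[p] : (0 < #|[set p in M | p.2 == u]|)%N by rewrite c1.
  rewrite in_set => /andP[pM /eqP pu]; apply/imsetP; exists p => //.
  by rewrite in_set pM pu.
apply: leq_trans (leq_add leA leB) _; rewrite -cardsUI.
rewrite [X in (_ + X)%N](_ : _ = 0%N) ?addn0; last first.
  apply/eqP; rewrite cards_eq0; apply/eqP/setP => p; rewrite in_set0 in_setI.
  apply/negP; rewrite in_set => /andP[/andP[/larcsP[x [z [xI fx ->]]]]].
  rewrite in_set => + /andP[_].
  have [-> _] := lift_arc_cls z clLA xI; have [_ ->] := lift_arc_cls z clN xI.
  by have [ve _ _] := items_valid xI; have := ep_exact ve fx => /[swap] -> /[swap] ->.
by apply/subset_leq_card/subsetP => p; rewrite in_setU !in_set => /orP[] /andP[].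
Qed.

Lemma lift_tight : [/\ bipartite Gg, EDCS beta betam Gg Hg,
    mu Hg = #|larcs (Some true)| & (#|larcs (Some false)| <= mu Gg)%N].
Proof.
have orH := larcs_oriented (k := None).
have bipH := arc_graph_bip orH; have bipG := arc_graph_bip orG.
split; [by exists vside|exact: lift_EDCS| |].
  apply/eqP; rewrite eqn_leq; apply/andP; split.
    apply: leq_trans card_lift_cover; apply: (mu_le_cover bipH).
    by rewrite (arcs_arc_graph orH) lift_cover.
  apply: (omatching_le_mu bipH); apply: larcs_matching => //.
  by rewrite (arcs_arc_graph orH) larcs_MH.
apply: (omatching_le_mu bipG); apply: larcs_matching => //.
by rewrite (arcs_arc_graph orG) subsetUr.
Qed.

End Lift.

Lemma profile_graph : exists (T : finType) (G H : sgraph T) (c : nat),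
  [/\ (0 < c)%N, bipartite G, EDCS beta betam G H,
      mu H = ((\sum_(e in EP | eM e) Y e) * c)%N
    & ((\sum_(e in EP | eMs e) Y e) * c <= mu G)%N].
Proof.
have [pos posP] := items_assignment.
have pos_lt v (vVP : v \in VP) : (0 < X v)%N -> forall x, (pos v x < X v)%N.
  by have [] := posP v vVP.
have card_pos v (vVP : v \in VP) := (posP v vVP).2.
have [bG eGH muH muG] := lift_tight pos_lt card_pos.
do 3!eexists; exists item_count.+1; split; [by []|exact: bG|exact: eGH| |].
  by rewrite muH card_larcs.
by move: muG; rewrite card_larcs.
Qed.

End TightGraph.

(** * The optimum and its tight graph *)

(** Shows, through [EDCS_lp_feasible], that the program has a feasible point. The degree sum on the
    edge is 2, which [beta] allows. *)
Lemma single_edge_EDCS (beta betam : nat) : (1 < beta)%N ->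
  exists (T : finType) (G : sgraph T),
    [/\ bipartite G, EDCS beta betam G G & (0 < mu G)%N].
Proof.
move=> beta_gt1; pose D : {set bool * bool} := [set (true, false)].
have orD : oriented id D by move=> p; rewrite inE => /eqP ->.
have bipD := arc_graph_bip orD.
exists bool, (arc_graph D); split; first by exists id.
- split=> // [u v _|u v ->] //.
  have deg1 w : (deg (arc_graph D) w <= 1)%N.
    rewrite -(cards1 (~~ w)); apply/subset_leq_card/subsetP => t.
    by rewrite !inE => /bipD; case: w t => [] [].
  exact: leq_trans (leq_add (deg1 u) (deg1 v)) _.
- have : omatching (arcs (arc_graph D) id) D.
    by rewrite arcs_arc_graph //; split=> // x y; rewrite !inE => /eqP -> /eqP ->.
  by move/(omatching_le_mu bipD); rewrite cards1.
Qed.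

Lemma lp_tight_graph (beta betam : nat) (xv : vprofile beta -> rat) xe :
  lp_feasible betam xv xe ->
  exists (T : finType) (G H : sgraph T),
    [/\ bipartite G, EDCS beta betam G H, (0 < mu H)%N
      & lp_objective betam xe * (mu H)%:R <= (mu G)%:R].
Proof.
move=> fx; pose q (i : vprofile beta + eprofile beta) :=
  match i with inl v => xv v | inr e => xe e end.
have [D D_gt0 qD] := common_denominator q.
(* Multiples by the common denominator are natural numbers, so truncation is exact. *)
have scale i : 0 <= q i -> (Num.truncn (q i * D%:R))%:R = q i * D%:R.
  by move=> q0; rewrite truncnK // natrEint qD mulr_ge0.
pose X v := Num.truncn (xv v * D%:R); pose Y e := Num.truncn (xe e * D%:R).
have XE v : v \in VP beta -> (X v)%:R = xv v * D%:R.
  by move/(lp_xv_ge0 fx); apply: (scale (inl v)).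
have YE (P : pred (eprofile beta)) :
    (\sum_(e in EP beta betam | P e) Y e)%:R =
    (\sum_(e in EP beta betam | P e) xe e) * D%:R.
  rewrite natr_sum mulr_suml; apply: eq_bigr => e /andP[eEP _].
  exact: (scale (inr e) (lp_xe_ge0 fx eEP)).
have XY k v : v \in VP beta ->
    (\sum_(e in EP beta betam | flag k e && at_v v e) Y e = wt k v * X v)%N.
  move=> vVP; apply/eqP; rewrite -(eqr_nat rat) natrM XE // YE.
  by rewrite (lp_kind fx) // mulrA.
have [T [G [H [c [c_gt0 bipG eGH muH muG]]]]] := profile_graph XY.
have sumM : (\sum_(e in EP beta betam | eM e) Y e)%N = D.
  by apply/eqP; rewrite -(eqr_nat rat) YE (lp_norm fx) mul1r.
exists T, G, H; split=> //; first by rewrite muH sumM muln_gt0 D_gt0.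
by rewrite muH sumM natrM mulrA -YE -natrM ler_nat.
Qed.

Theorem theorem3p1 (R : realFieldType) (beta betam : nat)
    (betam_ge1 : (1 <= betam)%N) (betam_lt : (betam < beta)%N) :
  (exists r : R, lp_optimal_value beta betam r) /\
  (forall r : R, lp_optimal_value beta betam r ->
    (forall (T : finType) (G H : sgraph T),
        bipartite G -> EDCS beta betam G H ->
        r * (mu H)%:R >= (mu G)%:R) /\
    (exists (T : finType) (G H : sgraph T),
        [/\ bipartite G, EDCS beta betam G H, (0 < mu H)%N
          & r * (mu H)%:R = (mu G)%:R])).
Proof.
have beta_gt1 : (1 < beta)%N by apply: leq_ltn_trans betam_lt.
have [T0 [G0 [bip0 e0 mu0]]] := single_edge_EDCS betam beta_gt1.
have [xv0 [xe0 [fx0 _]]] := EDCS_lp_feasible R beta_gt1 bip0 e0 mu0.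
have [xv [xe [fx xmax]]] := lp_rational_optimum betam_ge1 fx0.
have objE : lp_objective betam (fun e => ratr (xe e) : R) =
    ratr (lp_objective betam xe) by rewrite [RHS]rmorph_sum.
have fxR := lp_feasible_ratr R fx.
split.
  exists (ratr (lp_objective betam xe)); split=> //.
  by do 2!eexists; split; [exact: fxR|].
move=> r [[yv [ye [fy <-]]] ymax].
(* Any optimum over [R] has the value of the rational one, so the tight graph can be built from
   rational data. *)
have -> : lp_objective betam ye = ratr (lp_objective betam xe).
  by apply/le_anti; rewrite (xmax _ _ fy) -objE (ymax _ _ fxR).
have upper (T : finType) (G H : sgraph T) : bipartite G -> EDCS beta betam G H ->
    ratr (lp_objective betam xe) * (mu H)%:R >= (mu G)%:R :> R.
  move=> bipG eGH; have [muH|muH] := posnP (mu H).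
    by rewrite (EDCS_mu_eq0 betam_ge1 bipG eGH muH) muH mulr0.
  have [zv [ze [fz <-]]] := EDCS_lp_feasible R beta_gt1 bipG eGH muH.
  by rewrite ler_wpM2r // (xmax _ _ fz).
split=> //; have [T [G [H [bipG eGH muH le_mu]]]] := lp_tight_graph fx.
exists T, G, H; split=> //; apply/le_anti; rewrite upper // andbT.
by rewrite -(ratr_nat R (mu H)) -(ratr_nat R (mu G)) -rmorphM ler_rat.
Qed.
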